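(* There is a polynomial time approximation algorithm for \textsc{Max Min FVS} with approximation ratio $O(n^{2/3})$, where $n$ is the number of vertices of the input graph.
   Context: All graphs are finite, simple and loopless. A feedback vertex set (fvs) of $G=(V,E)$ is a set $S\subseteq V$ such that the subgraph induced by $V\setminus S$ is a forest; it is minimal if no proper subset of it is an fvs. $\mathrm{mmfvs}(G)$ is the maximum size of a minimal fvs of $G$. \textsc{Max Min FVS}: given a graph $G$, find a minimal fvs of $G$ of maximum size. An approximation algorithm with ratio $r\ge 1$ (possibly depending on $n$) is one which, given $G$, returns a minimal fvs of $G$ of size at least $\mathrm{mmfvs}(G)/r$. *)

(* Defs.v *)
From mathcomp Require Import all_boot all_order all_algebra.
From mathcomp Require Import boolp.
Set Implicit Arguments.
Unset Strict Implicit.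
Unset Printing Implicit Defensive.

(** * Graphs, given by a symmetric irreflexive relation on a finite type *)

Section FeedbackVertexSets.
Variables (T : finType) (e : rel T).
Implicit Types (A S : {set T}).

Definition induced A : rel {x | x \in A} := relpre val e.
Arguments induced : clear implicits.

(* [ucycle e c] also holds of the closed walk [:: x; y] along an edge, which
   is not a cycle of a simple graph; hence the lower bound on [size c]. *)
Definition acyclic (V : finType) (f : rel V) : Prop :=
  forall c : seq V, 2 < size c -> ~ ucycle f c.

Definition fvs S : Prop := acyclic (induced (~: S)).

Definition minimal_fvs S : Prop :=
  fvs S /\ forall S', S' \proper S -> ~ fvs S'.

Definition mmfvs : nat := \max_(S : {set T} | `[< minimal_fvs S >]) #|S|.

End FeedbackVertexSets.

(** * Machine model

  Structured programs for a random access machine with registers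
  [reg 0, reg 1, ...] and arrays [arr 0, arr 1, ...] of unbounded natural
  numbers. A program names finitely many registers and arrays; array cells are
  addressed indirectly. Every operation and every test has unit cost.
  The only arithmetic is addition and truncated subtraction, so that
  values have at most t + O(log n) bits after t steps and polynomial time is
  the same as for Turing machines. *)

Record state := State { reg : nat -> nat; arr : nat -> nat -> nat }.

Definition upd (V : Type) (f : nat -> V) (i : nat) (v : V) : nat -> V :=
  fun j => if j == i then v else f j.

Definition set_reg (s : state) x v := State (upd (reg s) x v) (arr s).
Definition set_arr (s : state) a i v :=
  State (reg s) (upd (arr s) a (upd (arr s a) i v)).

Inductive cmd : Type :=
| Skip
| Const (x k : nat)       (* reg x := k *)
| Add (x y z : nat)       (* reg x := reg y + reg z *)
| Sub (x y z : nat)       (* reg x := reg y - reg z *)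
| Read (x a y : nat)      (* reg x := arr a (reg y) *)
| Write (a x y : nat)     (* arr a (reg x) := reg y *)
| Seq (c1 c2 : cmd)
| If (x : nat) (c1 c2 : cmd)   (* c1 if reg x is nonzero, else c2 *)
| While (x : nat) (c : cmd).   (* as long as reg x is nonzero *)

(* [exec c s t s']: started in [s], [c] halts in [s'] after [t] steps. *)
Inductive exec : cmd -> state -> nat -> state -> Prop :=
| ESkip s : exec Skip s 1 s
| EConst s x k : exec (Const x k) s 1 (set_reg s x k)
| EAdd s x y z : exec (Add x y z) s 1 (set_reg s x (reg s y + reg s z))
| ESub s x y z : exec (Sub x y z) s 1 (set_reg s x (reg s y - reg s z))
| ERead s x a y : exec (Read x a y) s 1 (set_reg s x (arr s a (reg s y)))
| EWrite s a x y : exec (Write a x y) s 1 (set_arr s a (reg s x) (reg s y))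
| ESeq c1 c2 s t1 s1 t2 s2 :
    exec c1 s t1 s1 -> exec c2 s1 t2 s2 -> exec (Seq c1 c2) s (t1 + t2) s2
| EIfTrue x c1 c2 s t s1 :
    reg s x != 0 -> exec c1 s t s1 -> exec (If x c1 c2) s t.+1 s1
| EIfFalse x c1 c2 s t s1 :
    reg s x == 0 -> exec c2 s t s1 -> exec (If x c1 c2) s t.+1 s1
| EWhileTrue x c s t1 s1 t2 s2 :
    reg s x != 0 -> exec c s t1 s1 -> exec (While x c) s1 t2 s2 ->
    exec (While x c) s (t1 + t2).+1 s2
| EWhileFalse x c s : reg s x == 0 -> exec (While x c) s 1 s.

(* A graph on 'I_n is input as n in register 0 and its adjacency matrix, row by
   row, in array 0; all the rest is 0. *)
Definition input (n : nat) (e : rel 'I_n) : state :=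
  State (fun x => if x == 0 then n else 0)
        (fun a k => if a == 0
           then nat_of_bool [exists i : 'I_n, exists j : 'I_n, (k == i * n + j) && e i j]
           else 0).

(* A set of vertices is output as the nonzero entries of array 1. *)
Definition output (n : nat) (s : state) : {set 'I_n} :=
  [set i : 'I_n | arr s 1 i != 0].

(* Main.v *)
(** Let [F] be a maximal induced forest, obtained greedily, and [k = n - #|F|].
  Since the complement of a maximal induced forest is a minimal fvs, we are done
  when [k >= n^(1/3)]. Otherwise let [Fs] be the complement of an optimal
  solution. A vertex [v] of [F] outside [Fs] closes a cycle with [Fs], hence is
  linked inside [Fs :&: F] to two vertices [u], [w] outside [F], possibly equal;
  one of the at most [k^2] sets [U = {u, w}] serves a fraction [1 / k^2] of these [v].

  For fixed [U], ignore the set [double] of vertices of [F] with two neighbours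
  in [U]; call the vertices with one neighbour in [U] terminals, and root at a
  terminal every tree of [F] that contains one. If [N] is the set of the
  terminals that are not roots, counting edges shows that [U] serves at most
  [#|double| + #|N|] vertices [v]. Conversely, label each root [true], and let
  every other vertex inherit the label of its parent, flipped at terminals.
  Then [U] with the vertices labelled [p] induces a forest, and, again by counting
  edges, a forest containing it contains at most one element of [double] and of
  the members of [N] labelled [~~ p]. So one of the two forests, extended greedily,
  gives a minimal fvs of size at least [(#|double| + #|N|) / 2 - 1]. *)

From mathcomp Require Import all_boot all_order all_algebra boolp.
From mathcomp Require Import zify.
Require Import Defs.
Set Implicit Arguments.
Unset Strict Implicit.
Unset Printing Implicit Defensive.

(** * Compilation of a loop language *)

(** The flip at terminals gives every connected piece of a label class exactly one terminal, its top
    vertex. Such a piece hangs from [U] by a single edge and closes no cycle, whereas a terminal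
    just below it has one edge to the piece and one to [U]. A forest has room for at most [#|U| - 1]
    vertices with two such edges, since [U] may have two components; this is the origin of the
    subtracted 1.

    Vertices with two neighbours in [U] may be ignored because a link through one of them leads to
    both elements of [U], and then a single vertex already serves.

    All of this is expressed by inequalities between numbers of edges and of vertices, so that
    trees, parents and components are never represented as such.

    The threshold [n^(1/3)] balances two losses: [n / k] from the trivial bound [n] on the optimum,
    and about [k^2] from the choice of a pair.

    The algorithm is written in a language whose loops all run exactly [n] rounds, so a time bound
    depending on [n] alone follows by induction on the program. *)

Definition runs (c : cmd) (s : state) (B : nat) (Q : state -> Prop) : Prop :=
  exists t s', [/\ exec c s t s', t <= B & Q s'].

Lemma runs_weaken c s B B' (Q Q' : state -> Prop) :
  B <= B' -> (forall s', Q s' -> Q' s') -> runs c s B Q -> runs c s B' Q'.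
Proof.
move=> leB QQ' [t [s' [ex le_t Qs']]]; exists t, s'; split=> //; last exact: QQ'.
exact: leq_trans leB.
Qed.

Lemma runs_seq c1 c2 s B1 B2 (Q1 Q2 : state -> Prop) :
  runs c1 s B1 Q1 -> (forall s1, Q1 s1 -> runs c2 s1 B2 Q2) ->
  runs (Seq c1 c2) s (B1 + B2) Q2.
Proof.
move=> [t1 [s1 [ex1 le1 /[swap] H /H [t2 [s2 [ex2 le2 Q]]]]]].
exists (t1 + t2), s2; split=> //; [exact: ESeq ex1 ex2 | exact: leq_add].
Qed.

Lemma runs_const s x k (Q : state -> Prop) :
  Q (set_reg s x k) -> runs (Const x k) s 1 Q.
Proof. by move=> q; do 2!eexists; split; [exact: EConst | |]. Qed.

Lemma runs_add s x y z (Q : state -> Prop) :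
  Q (set_reg s x (reg s y + reg s z)) -> runs (Add x y z) s 1 Q.
Proof. by move=> q; do 2!eexists; split; [exact: EAdd | |]. Qed.

Lemma runs_sub s x y z (Q : state -> Prop) :
  Q (set_reg s x (reg s y - reg s z)) -> runs (Sub x y z) s 1 Q.
Proof. by move=> q; do 2!eexists; split; [exact: ESub | |]. Qed.

Lemma runs_read s x a y (Q : state -> Prop) :
  Q (set_reg s x (arr s a (reg s y))) -> runs (Read x a y) s 1 Q.
Proof. by move=> q; do 2!eexists; split; [exact: ERead | |]. Qed.

Lemma runs_write s a x y (Q : state -> Prop) :
  Q (set_arr s a (reg s x) (reg s y)) -> runs (Write a x y) s 1 Q.
Proof. by move=> q; do 2!eexists; split; [exact: EWrite | |]. Qed.

Lemma runs_if x c1 c2 s B (Q : state -> Prop) :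
  (reg s x != 0 -> runs c1 s B Q) -> (reg s x = 0 -> runs c2 s B Q) ->
  runs (If x c1 c2) s B.+1 Q.
Proof.
have [x0 _ /(_ x0)|x0 /(_ isT) + _] := eqVneq (reg s x) 0.
  move=> [t [s' [ex le_t q]]]; exists t.+1, s'; split=> //.
  by apply: EIfFalse ex; rewrite x0.
move=> [t [s' [ex le_t q]]]; exists t.+1, s'; split=> //.
exact: EIfTrue ex.
Qed.

Lemma runs_while_true x c s B1 B2 (Q1 Q2 : state -> Prop) :
  reg s x != 0 -> runs c s B1 Q1 ->
  (forall s1, Q1 s1 -> runs (While x c) s1 B2 Q2) ->
  runs (While x c) s (B1 + B2).+1 Q2.
Proof.
move=> x0 [t1 [s1 [ex1 le1 /[swap] H /H [t2 [s2 [ex2 le2 Q]]]]]].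
exists (t1 + t2).+1, s2; split=> //; first exact: EWhileTrue ex1 ex2.
by rewrite ltnS leq_add.
Qed.

Lemma runs_while_false x c s (Q : state -> Prop) :
  reg s x = 0 -> Q s -> runs (While x c) s 1 Q.
Proof.
by move=> x0 q; exists 1, s; split=> //; apply: EWhileFalse; rewrite x0.
Qed.

(* Register 0 keeps [n]; odd registers hold the variables of the loop language,
   the remaining even ones the temporaries of compiled code. *)
Definition var x := x.*2.+1.
Definition tmp d := d.*2.+2.

Definition tmp_at_least d r := ~~ odd r && (tmp d <= r).

(** Frame condition: code compiled at depth [d] treats the temporaries from [tmp d] on as a stack of
    its own, so the enclosing computation finds its values intact. *)
Definition same_below d (s s' : state) :=
  forall r, ~~ tmp_at_least d r -> reg s' r = reg s r.

(* Temporaries: [d] counts the rounds, [d.+1] is [n] minus the counter, [d.+2]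
   saves the variable [x], and [d.+3], [d.+4] hold the constants 0 and 1. *)
Definition loop d x (body : cmd) : cmd :=
  Seq (Const (tmp d.+3) 0)
 (Seq (Const (tmp d.+4) 1)
 (Seq (Add (tmp d.+2) (var x) (tmp d.+3))
 (Seq (Const (tmp d) 0)
 (Seq (Sub (tmp d.+1) 0 (tmp d))
 (Seq (While (tmp d.+1)
        (Seq (Add (var x) (tmp d) (tmp d.+3))
        (Seq body
        (Seq (Add (tmp d) (tmp d) (tmp d.+4))
             (Sub (tmp d.+1) 0 (tmp d))))))
      (Add (var x) (tmp d.+2) (tmp d.+3))))))).

Lemma same_below_trans d s1 s2 s3 :
  same_below d s1 s2 -> same_below d s2 s3 -> same_below d s1 s3.
Proof. by move=> s12 s23 r r_d; rewrite s23 ?s12. Qed.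

Lemma same_below_tmp d d' s s' :
  same_below d s s' -> d' < d -> reg s' (tmp d') = reg s (tmp d').
Proof. by move=> + ltd; apply; rewrite /tmp_at_least /tmp; lia. Qed.

Lemma same_below_var d s s' x :
  same_below d s s' -> reg s' (var x) = reg s (var x).
Proof. by apply; rewrite /tmp_at_least /var; lia. Qed.

Lemma same_below0 d s s' : same_below d s s' -> reg s' 0 = reg s 0.
Proof. by apply; rewrite /tmp_at_least /tmp; lia. Qed.

Lemma same_belowW d d' s s' : d <= d' -> same_below d' s s' -> same_below d s s'.
Proof.
by move=> led + r r_d; apply; move: r_d; rewrite /tmp_at_least /tmp; lia.
Qed.

Definition loop_reg d r := [&& tmp d <= r, r < tmp (d + 5) & ~~ odd r].

Ltac regs := rewrite /= /upd;
  repeat (case: eqP => ?; try by exfalso; unfold loop_reg, tmp_at_least, tmp, var in *; lia);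
  try by lia.

(** [Inv] has to be stable under changes of [var x] and of the five registers of the loop, which are
    written between rounds. The variable is reloaded from the private counter before each round and
    restored at the end, so the body may leave anything in it and nested loops may share it. A round
    costs 4 extra steps (test, load, increment, remaining count); the 7 are the five initial
    instructions, the last test and the restoration. *)
Lemma runs_loop d x body n B (Inv : nat -> state -> Prop) s :
  reg s 0 = n ->
  Inv 0 s ->
  (forall i s1 s2, arr s2 = arr s1 ->
     (forall r, r != var x -> ~~ loop_reg d r ->
       reg s2 r = reg s1 r) ->
     Inv i s1 -> Inv i s2) ->
  (forall i s1, i < n -> reg s1 0 = n -> reg s1 (var x) = i -> Inv i s1 ->
     runs body s1 B (fun s2 => [/\ forall r, loop_reg d r -> reg s2 r = reg s1 r,
       reg s2 0 = reg s1 0 & Inv i.+1 s2])) ->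
  runs (loop d x body) s (n * (B + 4) + 7)
    (fun s' => [/\ Inv n s', reg s' (var x) = reg s (var x) & reg s' 0 = n]).
Proof.
move=> s0 Inv0 stable step.
have stable1 i s1 r v : (r == var x) || loop_reg d r ->
    Inv i s1 -> Inv i (set_reg s1 r v).
  move=> rP; apply: stable => //= r' r'x r'd; rewrite /upd; case: eqP => // r'r.
  by subst r'; move: rP; rewrite (negPf r'x) /= (negPf r'd).
have wh i s1 : i <= n -> reg s1 0 = n -> reg s1 (tmp d) = i ->
    reg s1 (tmp d.+1) = n - i -> reg s1 (tmp d.+3) = 0 -> reg s1 (tmp d.+4) = 1 ->
    Inv i s1 ->
  runs (While (tmp d.+1)
        (Seq (Add (var x) (tmp d) (tmp d.+3))
        (Seq body
        (Seq (Add (tmp d) (tmp d) (tmp d.+4))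
             (Sub (tmp d.+1) 0 (tmp d)))))) s1 ((n - i) * (B + 4) + 1)
    (fun s' => [/\ Inv n s', reg s' (tmp d.+2) = reg s1 (tmp d.+2),
       reg s' (tmp d.+3) = 0 & reg s' 0 = n]).
  move: {2}(n - i) (erefl (n - i)) => m.
  elim: m i s1 => [|m IHm] i s1 mE lein s10 cE tE zE oneE Invi.
    have -> : (n - i) * (B + 4) + 1 = 1 by rewrite mE.
    apply: runs_while_false; first by rewrite tE mE.
    by split=> //; have <- : i = n by lia.
  have -> : (n - i) * (B + 4) + 1 = ((1 + (B + (1 + 1))) + ((n - i.+1) * (B + 4) + 1)).+1.
    by rewrite mE subnS mE /=; lia.
  apply: (@runs_while_true _ _ _ _ _ (fun s' => [/\ reg s' 0 = n,
      reg s' (tmp d) = i.+1, reg s' (tmp d.+1) = n - i.+1 &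
      [/\ reg s' (tmp d.+2) = reg s1 (tmp d.+2),
      reg s' (tmp d.+3) = 0, reg s' (tmp d.+4) = 1 & Inv i.+1 s']])).
  - by rewrite tE mE.
  - apply: (@runs_seq _ _ _ _ _ (fun s' => s' = set_reg s1 (var x) i)).
      by apply: runs_add; rewrite zE cE addn0.
    move=> _ ->; apply: runs_seq.
      apply: (step i) => //=; [lia | by rewrite /upd eqxx |].
      by apply: (stable1); rewrite ?eqxx.
    move=> s2 /= [sm s20 Inv2].
    have tmpE k : k < 5 -> reg s2 (tmp (d + k)) = reg s1 (tmp (d + k)).
      move=> k5; rewrite sm; first by regs.
      by rewrite /loop_reg /tmp; lia.
    rewrite /upd /= s10 in s20.
    have e0 := tmpE 0 isT; have e2 := tmpE 2 isT.
    have e3 := tmpE 3 isT; have e4 := tmpE 4 isT.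
    rewrite addn0 in e0; rewrite !addnS addn0 in e2 e3 e4.
    apply: (@runs_seq _ _ _ _ _ (fun s' => s' = set_reg s2 (tmp d) i.+1)).
      by apply: runs_add; rewrite e0 e4 cE oneE addn1.
    move=> _ ->; set s3 := set_reg _ _ _.
    have s3E : reg s3 0 - reg s3 (tmp d) = n - i.+1 by rewrite /= /upd eqxx s20.
    apply: runs_sub; rewrite s3E.
    split; last split.
    + by rewrite /= /upd.
    + by rewrite /= /upd ifF ?eqxx // /tmp; lia.
    + by rewrite /= /upd eqxx.
    + by rewrite /= /upd !ifF // /tmp; lia.
    + by rewrite /= /upd !ifF ?e3 // /tmp; lia.
    + by rewrite /= /upd !ifF ?e4 // /tmp; lia.
    + by apply: (stable1); [|apply: (stable1) => //]; apply/orP; right; rewrite /loop_reg /tmp; lia.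
  - move=> s2 [? ? ? [e2 ? ? ?]]; rewrite -e2.
    apply: IHm => //; lia.
apply: (@runs_weaken _ _ (1 + (1 + (1 + (1 + (1 + (n * (B + 4) + 1 + 1)))))) ); [lia | by move=> ?; apply |].
apply: (@runs_seq _ _ _ _ _ (fun s' => s' = set_reg s (tmp d.+3) 0)); first exact: runs_const.
move=> _ ->; set s1 := set_reg _ _ _.
apply: (@runs_seq _ _ _ _ _ (fun s' => s' = set_reg s1 (tmp d.+4) 1)); first exact: runs_const.
move=> _ ->; set s2 := set_reg _ _ _.
have s3E : reg s2 (var x) + reg s2 (tmp d.+3) = reg s (var x).
  by rewrite /= /upd eqxx !ifF ?addn0 // /tmp /var; lia.
apply: (@runs_seq _ _ _ _ _ (fun s' => s' = set_reg s2 (tmp d.+2) (reg s (var x)))).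
  by apply: runs_add; rewrite s3E.
move=> _ ->; set s3 := set_reg _ _ _.
apply: (@runs_seq _ _ _ _ _ (fun s' => s' = set_reg s3 (tmp d) 0)); first exact: runs_const.
move=> _ ->; set s4 := set_reg _ _ _.
have s5E : reg s4 0 - reg s4 (tmp d) = n by rewrite /= /upd /= eqxx subn0.
apply: (@runs_seq _ _ _ _ _ (fun s' => s' = set_reg s4 (tmp d.+1) n)).
  by apply: runs_sub; rewrite s5E.
move=> _ ->; set s5 := set_reg _ _ _.
have <- : n - 0 = n by rewrite subn0.
apply: runs_seq.
  apply: wh => //.
  - by regs.
  - by regs.
  - by regs.
  - by regs.
  - by do 5!(apply: (stable1); first by (apply/orP; right; rewrite /loop_reg /tmp; lia)).
rewrite subn0 => s6 [Inv6 e2 e3 e0]; apply: runs_add; split.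
- by apply: (stable1); rewrite ?eqxx.
- by rewrite /= e2 e3; regs.
- by rewrite /= /upd.
Qed.

(* [Inp] reads the adjacency matrix, [Cell a] the work array [a], stored in array
   [a.+2] of the machine. [Tot x e] is the sum of [e] over all [x < n], and
   [Map a x e] assigns [e] to all cells [x < n] of [a] simultaneously. *)
Inductive expr :=
| Var (x : nat)
| Lit (k : nat)
| Inp (e : expr)
| Cell (a : nat) (e : expr)
| Plus (e1 e2 : expr)
| Minus (e1 e2 : expr)
| Ite (e e1 e2 : expr)
| Tot (x : nat) (e : expr).

Inductive com :=
| Map (a x : nat) (e : expr)
| For (x : nat) (c : com)
| Then (c1 c2 : com).

Section Semantics.
Variables (n : nat) (inp : nat -> nat).

Fixpoint eval (rho : nat -> nat) (sigma : nat -> nat -> nat) (e : expr) : nat :=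
  match e with
  | Var x => rho x
  | Lit k => k
  | Inp e => inp (eval rho sigma e)
  | Cell a e => sigma a (eval rho sigma e)
  | Plus e1 e2 => eval rho sigma e1 + eval rho sigma e2
  | Minus e1 e2 => eval rho sigma e1 - eval rho sigma e2
  | Ite e e1 e2 =>
      if eval rho sigma e != 0 then eval rho sigma e1 else eval rho sigma e2
  | Tot x e => \sum_(i < n) eval (upd rho x i) sigma e
  end.

Fixpoint sem (rho : nat -> nat) (sigma : nat -> nat -> nat) (c : com) :
    nat -> nat -> nat :=
  match c with
  | Map a x e =>
      upd sigma a (fun j => if j < n then eval (upd rho x j) sigma e else sigma a j)
  | For x c => iteri n (fun i sigma' => sem (upd rho x i) sigma' c) sigma
  | Then c1 c2 => sem rho (sem rho sigma c1) c2
  end.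

Definition rep rho sigma (s : state) :=
  [/\ reg s 0 = n, forall k, arr s 0 k = inp k, forall x, reg s (var x) = rho x &
      forall a k, arr s a.+2 k = sigma a k].

End Semantics.

Fixpoint comp_expr (d : nat) (e : expr) : cmd :=
  match e with
  | Var x => Seq (Const (tmp d) 0) (Add (tmp d) (tmp d) (var x))
  | Lit k => Const (tmp d) k
  | Inp e => Seq (comp_expr d e) (Read (tmp d) 0 (tmp d))
  | Cell a e => Seq (comp_expr d e) (Read (tmp d) a.+2 (tmp d))
  | Plus e1 e2 => Seq (comp_expr d e1)
      (Seq (comp_expr d.+1 e2) (Add (tmp d) (tmp d) (tmp d.+1)))
  | Minus e1 e2 => Seq (comp_expr d e1)
      (Seq (comp_expr d.+1 e2) (Sub (tmp d) (tmp d) (tmp d.+1)))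
  | Ite e e1 e2 => Seq (comp_expr d e)
      (If (tmp d) (comp_expr d e1) (comp_expr d e2))
  | Tot x e => Seq (Const (tmp d) 0)
      (loop d.+1 x (Seq (comp_expr (d + 6) e) (Add (tmp d) (tmp d) (tmp (d + 6)))))
  end.

(* Since [e] may read [a], the new values are first collected in array 1. *)
Fixpoint comp_com (d : nat) (c : com) : cmd :=
  match c with
  | Map a x e =>
      Seq (loop d x (Seq (comp_expr (d + 5) e) (Write 1 (var x) (tmp (d + 5)))))
          (loop d x (Seq (Read (tmp (d + 5)) 1 (var x))
                         (Write a.+2 (var x) (tmp (d + 5)))))
  | For x c => loop d x (comp_com (d + 5) c)
  | Then c1 c2 => Seq (comp_com d c1) (comp_com d c2)
  end.

Lemma rep_same n inp rho sigma d s s' :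
  same_below d s s' -> arr s' = arr s -> rep n inp rho sigma s ->
  rep n inp rho sigma s'.
Proof.
move=> sm ea [s0 sin svar sarr]; split; rewrite ?ea //.
  by rewrite (same_below0 sm).
by move=> x; rewrite (same_below_var x sm).
Qed.

Lemma same_below_set d s v : same_below d s (set_reg s (tmp d) v).
Proof.
by move=> r r_d; rewrite /= /upd; case: eqP r_d => // ->; rewrite /tmp_at_least /tmp; lia.
Qed.

Lemma same_below_set_trans d s s' v :
  same_below d s s' -> same_below d s (set_reg s' (tmp d) v).
Proof. by move/same_below_trans; apply; exact: same_below_set. Qed.

Lemma rep_upd n inp rho sigma0 sigma s s' d x i :
  rep n inp rho sigma0 s ->
  (forall r, r != var x -> ~~ tmp_at_least d r -> reg s' r = reg s r) ->
  reg s' (var x) = i -> (forall k, arr s' 0 k = arr s 0 k) ->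
  (forall a, arr s' a.+2 =1 sigma a) ->
  rep n inp (upd rho x i) sigma s'.
Proof.
move=> [s0 sin svar sarr] same sx s'in s'arr; split.
- by rewrite same // /tmp_at_least /tmp /var; lia.
- by move=> k; rewrite s'in.
- move=> y; rewrite /upd; case: eqP => [->//|/eqP yx].
  by rewrite same ?svar // /tmp_at_least /tmp /var; move: yx; lia.
- exact: s'arr.
Qed.

Definition poly_bounded (f : nat -> nat) :=
  exists q : {poly nat}, forall n, f n <= q.[n]%R.

Lemma poly_bounded_const k : poly_bounded (fun=> k).
Proof. by exists (k%:P)%R => n; rewrite hornerC. Qed.

Lemma poly_bounded_id : poly_bounded id.
Proof. by exists 'X%R => n; rewrite hornerX. Qed.

Lemma poly_bounded_add f g : poly_bounded f -> poly_bounded g ->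
  poly_bounded (fun n => f n + g n).
Proof.
move=> [p fp] [q gq]; exists (p + q)%R => n; rewrite hornerD; exact: leq_add.
Qed.

Lemma poly_bounded_mul f g : poly_bounded f -> poly_bounded g ->
  poly_bounded (fun n => f n * g n).
Proof.
move=> [p fp] [q gq]; exists (p * q)%R => n; rewrite hornerM; exact: leq_mul.
Qed.

Ltac poly_bounded := repeat first [assumption | apply: poly_bounded_add
  | apply: poly_bounded_mul | apply: poly_bounded_id | apply: poly_bounded_const].

Definition expr_correct d e (q : nat -> nat) :=
  forall n inp rho sigma s, rep n inp rho sigma s ->
  runs (comp_expr d e) s (q n)
    (fun s' => [/\ same_below d s s', arr s' = arr s &
       reg s' (tmp d) = eval n inp rho sigma e]).

Lemma comp_expr_binop d e1 e2 (q1 q2 : nat -> nat) c (f : nat -> nat -> nat) :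
  (forall s Q, Q (set_reg s (tmp d) (f (reg s (tmp d)) (reg s (tmp d.+1)))) ->
     runs c s 1 Q) ->
  expr_correct d e1 q1 -> expr_correct d.+1 e2 q2 ->
  forall n inp rho sigma s, rep n inp rho sigma s ->
  runs (Seq (comp_expr d e1) (Seq (comp_expr d.+1 e2) c)) s (q1 n + (q2 n + 1))
    (fun s' => [/\ same_below d s s', arr s' = arr s &
       reg s' (tmp d) = f (eval n inp rho sigma e1) (eval n inp rho sigma e2)]).
Proof.
move=> cP H1 H2 n inp rho sigma s srep.
apply: runs_seq; first exact: (H1 _ _ _ _ _ srep).
move=> s1 [sm1 ea1 e1E]; have srep1 := rep_same sm1 ea1 srep.
apply: runs_seq; first exact: (H2 _ _ _ _ _ srep1).
move=> s2 [sm2 ea2 e2E]; apply: cP; split=> /=.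
- apply: same_below_trans sm1 _; apply: same_below_set_trans.
  by apply: same_belowW sm2.
- by rewrite ea2.
- by rewrite /upd eqxx e2E (same_below_tmp sm2) // e1E.
Qed.

Lemma comp_exprP e d : exists2 q, poly_bounded q & expr_correct d e q.
Proof.
elim: e d => [x|k|e IH|a e IH|e1 IH1 e2 IH2|e1 IH1 e2 IH2|e IH e1 IH1 e2 IH2|x e IH] d.
- exists (fun=> 2); first by poly_bounded.
  move=> n inp rho sigma s [s0 sin svar sarr].
  apply: (@runs_seq _ _ _ 1 1 (fun s' => s' = set_reg s (tmp d) 0)).
    exact: runs_const.
  move=> _ ->; apply: runs_add; split=> //.
    by do 2![apply: same_below_set_trans].
  by rewrite [RHS]/= -svar; regs.
- exists (fun=> 1); first by poly_bounded.
  move=> n inp rho sigma s srep.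
  by apply: runs_const; split=> //=; [exact: same_below_set | rewrite /upd eqxx].
- have [q qP IHq] := IH d; exists (fun n => q n + 1); first by poly_bounded.
  move=> n inp rho sigma s srep.
  apply: runs_seq; first exact: (IHq _ _ _ _ _ srep).
  move=> s1 [sm1 ea1 eE]; apply: runs_read; split=> //=.
    exact: same_below_set_trans.
  by rewrite /upd eqxx eE ea1; case: srep.
- have [q qP IHq] := IH d; exists (fun n => q n + 1); first by poly_bounded.
  move=> n inp rho sigma s srep.
  apply: runs_seq; first exact: (IHq _ _ _ _ _ srep).
  move=> s1 [sm1 ea1 eE]; apply: runs_read; split=> //=.
    exact: same_below_set_trans.
  by rewrite /upd eqxx eE ea1; case: srep.
- have [q1 q1P H1] := IH1 d; have [q2 q2P H2] := IH2 d.+1.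
  exists (fun n => q1 n + (q2 n + 1)); first by poly_bounded.
  apply: (comp_expr_binop (f := addn)) => // s Q.
  exact: runs_add.
- have [q1 q1P H1] := IH1 d; have [q2 q2P H2] := IH2 d.+1.
  exists (fun n => q1 n + (q2 n + 1)); first by poly_bounded.
  apply: (comp_expr_binop (f := subn)) => // s Q.
  exact: runs_sub.
- have [q qP H] := IH d; have [q1 q1P H1] := IH1 d; have [q2 q2P H2] := IH2 d.
  exists (fun n => q n + (q1 n + q2 n + 1)); first by poly_bounded.
  move=> n inp rho sigma s srep.
  apply: runs_seq; first exact: (H _ _ _ _ _ srep).
  move=> s1 [sm1 ea1 eE]; have srep1 := rep_same sm1 ea1 srep.
  have wk c q' v : expr_correct d c q' -> q' n <= q1 n + q2 n ->
      v = eval n inp rho sigma c ->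
      runs (comp_expr d c) s1 (q1 n + q2 n)
    (fun s' => [/\ same_below d s s', arr s' = arr s & reg s' (tmp d) = v]).
    move=> cP le_q ->; apply: runs_weaken le_q _ (cP _ _ _ _ _ srep1) => s2.
    by case=> sm2 ea2 ?; split; rewrite ?ea2 //; exact: same_below_trans sm1 sm2.
  rewrite [X in runs _ _ X](_ : _ = (q1 n + q2 n).+1); last exact: addn1.
  apply: runs_if => c0.
    by apply: wk H1 _ _; [exact: leq_addr | rewrite /= -eE c0].
  by apply: wk H2 _ _; [exact: leq_addl | rewrite /= -eE c0].
- have [q qP H] := IH (d + 6).
  exists (fun n => 1 + (n * (q n + 1 + 4) + 7)); first by poly_bounded.
  move=> n inp rho sigma s srep.
  rewrite !hornerE.
  apply: (@runs_seq _ _ _ 1 (n * (q n + 1 + 4) + 7)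
    (fun s' => s' = set_reg s (tmp d) 0)); first exact: runs_const.
  move=> _ ->; set s1 := set_reg _ _ _.
  have sm1 : same_below d s s1 by exact: same_below_set.
  have srep1 : rep n inp rho sigma s1 by apply: rep_same sm1 _ srep.
  pose Inv i (s' : state) := [/\ arr s' = arr s,
    forall r, r != var x -> ~~ tmp_at_least d r -> reg s' r = reg s r &
    reg s' (tmp d) = \sum_(j < i) eval n inp (upd rho x j) sigma e].
  apply: (runs_weaken (leqnn _) _ (runs_loop (Inv := Inv) _ _ _ _)).
  + move=> s2 [[ea2 er2 eE] ex2 _]; split=> //.
    move=> r rd; have [->|rx] := eqVneq r (var x); last exact: er2.
    by rewrite ex2 (same_below_var x sm1).
  + by case: srep1.
  + split=> //; last by rewrite big_ord0 /s1; regs.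
    by move=> r rx rd; exact: sm1.
  + move=> i s2 s3 ea er [ea2 er2 eE]; split; rewrite ?ea //.
      move=> r rx rd; rewrite er ?er2 //.
      by move: rd; rewrite /loop_reg /tmp_at_least /tmp; lia.
    by rewrite er ?eE // /loop_reg /tmp /var; lia.
  + move=> i s2 lt_i s20 s2x [ea2 er2 eE].
    have srep2 : rep n inp (upd rho x i) sigma s2.
      apply: rep_upd er2 s2x _ _; first exact: srep; rewrite ea2 //.
      by case: srep.
    apply: runs_seq; first exact: (H _ _ _ _ _ srep2).
    move=> s3 [sm3 ea3 e3]; apply: runs_add.
    split.
    * move=> r rd; have <- : reg s3 r = reg s2 r.
        by apply: sm3; move: rd; rewrite /loop_reg /tmp_at_least /tmp; lia.
      by regs.
    * by rewrite /= /upd /= (same_below0 sm3).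
    * split=> /=; first by rewrite ea3.
        move=> r rx rd; rewrite -er2 //; have <- : reg s3 r = reg s2 r.
          by apply: sm3; move: rd; rewrite /tmp_at_least /tmp; lia.
        by rewrite /upd; case: eqP rd => // ->; rewrite /tmp_at_least /tmp; lia.
      rewrite /upd eqxx e3 (same_below_tmp sm3) ?eE ?big_ord_recr //=; lia.
Qed.

Definition com_correct d c (q : nat -> nat) :=
  forall n inp rho sigma s, rep n inp rho sigma s ->
  runs (comp_com d c) s (q n)
    (fun s' => same_below d s s' /\ rep n inp rho (sem n inp rho sigma c) s').

(** Kept apart from [comp_comP] for its last conclusion: [rep] says nothing about array 1, where the
    output is read. *)
Lemma comp_MapP a x e d : exists2 q, poly_bounded q &
  forall n inp rho sigma s, rep n inp rho sigma s ->
  runs (comp_com d (Map a x e)) s (q n)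
    (fun s' => [/\ same_below d s s',
       rep n inp rho (sem n inp rho sigma (Map a x e)) s' &
       forall j, j < n -> arr s' 1 j = eval n inp (upd rho x j) sigma e]).
Proof.
have [q qP H] := comp_exprP e (d + 5).
exists (fun n => (n * (q n + 1 + 4) + 7) + (n * (1 + 1 + 4) + 7)); first by poly_bounded.
move=> n inp rho sigma s srep.
pose v j := eval n inp (upd rho x j) sigma e.
pose Inv1 i (s' : state) := [/\ 
    forall r, r != var x -> ~~ tmp_at_least d r -> reg s' r = reg s r,
    forall b, b != 1 -> arr s' b = arr s b &
    forall j, j < i -> arr s' 1 j = v j].
apply: runs_seq.
  apply: (runs_loop (Inv := Inv1)).
  - by case: srep.
  - by [].
  - move=> i s1 s2 ea er [er1 ea1 eE]; split; rewrite ?ea //.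
    move=> r rx rd; rewrite er ?er1 //.
    by move: rd; rewrite /loop_reg /tmp_at_least /tmp; lia.
  - move=> i s1 lt_i s10 s1x [er1 ea1 eE].
    have srep1 : rep n inp (upd rho x i) sigma s1.
      apply: rep_upd er1 s1x _ _; first exact: srep; first by rewrite ea1.
      by move=> b k; rewrite ea1 //; case: srep.
    apply: runs_seq; first exact: (H _ _ _ _ _ srep1).
    move=> s2 [sm2 ea2 e2]; apply: runs_write; split=> /=.
    + move=> r rd; apply: sm2; move: rd.
      by rewrite /loop_reg /tmp_at_least /tmp; lia.
    + by rewrite (same_below0 sm2).
    + split=> /=.
      * move=> r rx rd; rewrite sm2 ?er1 //.
        by move: rd; rewrite /tmp_at_least /tmp; lia.
      * by move=> b b1; rewrite /upd (negPf b1) ea2 ea1.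
      * move=> j; rewrite ltnS leq_eqVlt (same_below_var x sm2) s1x e2 /upd eqxx.
        by case: eqP => [->//|_ /= lt_ji]; rewrite ea2 eE.
move=> s1 [[er1 ea1 eE] e1x s10].
pose Inv2 i (s' : state) := [/\ 
    forall r, r != var x -> ~~ tmp_at_least d r -> reg s' r = reg s1 r,
    forall b, b != a.+2 -> arr s' b = arr s1 b &
    forall j, arr s' a.+2 j = if j < i then v j else arr s1 a.+2 j].
apply: (runs_weaken (leqnn _) _ (runs_loop (Inv := Inv2) _ _ _ _)).
- move=> s2 [[er2 ea2 eE2] e2x s20]; split.
  + move=> r rd; have [->|rx] := eqVneq r (var x); first by rewrite e2x e1x.
    by rewrite er2 ?er1.
  + split=> //; first by move=> k; rewrite ea2 // ea1 //; case: srep.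
      move=> y; have [->|yx] := eqVneq y x; first by rewrite e2x e1x; case: srep.
      have yx' : var y != var x by move: yx; rewrite /var; lia.
      have yd : ~~ tmp_at_least d (var y) by rewrite /tmp_at_least /var; lia.
      by rewrite er2 // er1 //; case: srep.
    move=> b k; rewrite /= /upd; case: (eqVneq b a) => [->|ba].
      by rewrite eE2 ea1 //; case: srep => _ _ _ ->.
    by rewrite ea2 ?ea1 ?eqSS //; case: srep.
  + by move=> j lt_j; rewrite ea2 // eE.
- by [].
- by [].
- move=> i s2 s3 ea er [er2 ea2 eE2]; split; rewrite ?ea //.
  move=> r rx rd; rewrite er ?er2 //.
  by move: rd; rewrite /loop_reg /tmp_at_least /tmp; lia.
- move=> i s2 lt_i s20 s2x [er2 ea2 eE2].
  apply: (@runs_seq _ _ _ _ _ (fun s' => s' = set_reg s2 (tmp (d + 5)) (v i))).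
    by apply: runs_read; rewrite s2x ea2 // eE.
  move=> _ ->; apply: runs_write; split=> /=.
  + by move=> r rd; regs.
  + by [].
  + split=> /=.
    * move=> r rx rd; rewrite -er2 // /upd; case: eqP rd => // ->.
      by rewrite /tmp_at_least /tmp; lia.
    * by move=> b ba; rewrite /upd (negPf ba) ea2.
    * move=> j; rewrite {1}/upd eqxx.
      have -> : upd (reg s2) (tmp (d + 5)) (v i) (var x) = i by rewrite -s2x; regs.
      rewrite /upd eqxx ltnS [j <= i]leq_eqVlt; case: eqP => [->//|_].
      exact: eE2.
Qed.

Lemma comp_comP c d : exists2 q, poly_bounded q & com_correct d c q.
Proof.
elim: c d => [a x e|x c IH|c1 IH1 c2 IH2] d.
- have [q qP H] := comp_MapP a x e d; exists q => // n inp rho sigma s srep.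
  by apply: runs_weaken (leqnn _) _ (H _ _ _ _ _ srep) => s' [].
- have [q qP H] := IH (d + 5); exists (fun n => n * (q n + 4) + 7); first by poly_bounded.
  move=> n inp rho sigma s srep.
  pose f i := iteri i (fun i sigma' => sem n inp (upd rho x i) sigma' c) sigma.
  pose Inv i (s' : state) := [/\ 
    forall r, r != var x -> ~~ tmp_at_least d r -> reg s' r = reg s r,
    forall k, arr s' 0 k = inp k & forall a k, arr s' a.+2 k = f i a k].
  apply: (runs_weaken (leqnn _) _ (runs_loop (Inv := Inv) _ _ _ _)).
  + move=> s' [[er ein ea] ex s'0]; have sm : same_below d s s'.
      move=> r rd; have [->|rx] := eqVneq r (var x); first by rewrite ex.
      exact: er.
    split=> //; split=> //.
    by move=> y; rewrite (same_below_var y sm); case: srep.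
  + by case: srep.
  + by case: srep.
  + move=> i s1 s2 ea er [er1 ein1 ea1]; split; rewrite ?ea //.
    move=> r rx rd; rewrite er ?er1 //.
    by move: rd; rewrite /loop_reg /tmp_at_least /tmp; lia.
  + move=> i s1 lt_i s10 s1x [er1 ein1 ea1].
    have srep1 : rep n inp (upd rho x i) (f i) s1.
      apply: rep_upd er1 s1x _ _; [exact: srep | | by []].
      by move=> k; rewrite ein1; case: srep.
    apply: runs_weaken (leqnn _) _ (H _ _ _ _ _ srep1) => s2 [sm2 [s20 ein2 _ ea2]].
    split.
    * move=> r rd; apply: sm2; move: rd.
      by rewrite /loop_reg /tmp_at_least /tmp; lia.
    * by rewrite (same_below0 sm2).
    * split=> // r rx rd; rewrite sm2 ?er1 //.
      by move: rd; rewrite /tmp_at_least /tmp; lia.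
- have [q1 q1P H1] := IH1 d; have [q2 q2P H2] := IH2 d.
  exists (fun n => q1 n + q2 n); first by poly_bounded.
  move=> n inp rho sigma s srep.
  apply: runs_seq; first exact: (H1 _ _ _ _ _ srep).
  move=> s1 [sm1 srep1].
  apply: runs_weaken (leqnn _) _ (H2 _ _ _ _ _ srep1) => s2 [sm2 srep2].
  by split=> //; exact: same_below_trans sm1 sm2.
Qed.

(** * Counting edges in forests *)

Section Forests.
Variables (T : finType) (e : rel T).
Hypotheses (e_sym : symmetric e) (e_irr : irreflexive e).
Implicit Types (A B S U W : {set T}) (x y v : T).

Lemma sum_setU A B (F : T -> nat) : [disjoint A & B] ->
  \sum_(x in A :|: B) F x = \sum_(x in A) F x + \sum_(x in B) F x.
Proof.
move=> dAB; rewrite -bigU //=; apply: eq_bigl => x; by rewrite !inE.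
Qed.

Definition dg A v : nat := \sum_(w in A) e v w.

(* Twice the number of edges inside [A]. *)
Definition dgsum A : nat := \sum_(v in A) dg A v.

(** Acyclicity in terms of degrees. This form passes to subsets at once, provides a leaf for
    inductions, and can be tested by stripping vertices of small degree; [acyclic_induced] relates
    it to cycles. *)
Definition forest A : Prop :=
  forall B, B \subset A -> B != set0 -> exists2 v, v \in B & dg B v <= 1.

Lemma dgS A B v : A \subset B -> dg A v <= dg B v.
Proof.
move=> sAB; rewrite /dg (big_setID (A := B) A) /= (setIidPr sAB); exact: leq_addr.
Qed.

Lemma dg0 v : dg set0 v = 0.
Proof. by rewrite /dg big_set0. Qed.

Lemma dg1 x v : dg [set x] v = e v x.
Proof. by rewrite /dg big_set1. Qed.

Lemma dgU A B v : [disjoint A & B] -> dg (A :|: B) v = dg A v + dg B v.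
Proof. exact: sum_setU. Qed.

Lemma dg_le A v n : #|A| <= n -> dg A v <= n.
Proof.
apply: leq_trans; rewrite /dg -sum1_card; apply: leq_sum => w _.
exact: leq_b1.
Qed.

Lemma dg_ge1 A v y : y \in A -> e v y -> 0 < dg A v.
Proof. by move=> yA evy; rewrite /dg (bigD1 y) //= evy. Qed.

Lemma dg_ge2 A v x y : x \in A -> y \in A -> x != y -> e v x -> e v y -> 1 < dg A v.
Proof.
move=> xA yA xy evx evy; rewrite /dg (bigD1 x) //= evx (bigD1 y) /= ?evy //.
by rewrite yA eq_sym.
Qed.

Lemma dg_gt0P A v : reflect (exists2 y, y \in A & e v y) (0 < dg A v).
Proof.
apply: (iffP idP) => [|[y yA evy]]; last exact: dg_ge1 evy.
rewrite lt0n /dg sum_nat_eq0 negb_forall_in => /exists_inP [y yA].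
by rewrite eqb0 negbK; exists y.
Qed.

Lemma dg_gt1_exists A v z : 1 < dg A v -> exists y, [/\ y \in A, e v y & y != z].
Proof.
move=> dg2; have : 0 < dg (A :\ z) v.
  rewrite -(ltn_add2l 1) addn0; apply: leq_trans dg2 _.
  apply: leq_trans (dgS v (_ : A \subset [set z] :|: A :\ z)) _.
    by rewrite -subDset.
  rewrite dgU; first by rewrite leq_add2r dg_le ?cards1.
  by rewrite disjoints1 !inE eqxx.
by case/dg_gt0P=> y; rewrite !inE => /andP [yz yA] evy; exists y.
Qed.

Lemma sum_dgC A B : \sum_(x in A) dg B x = \sum_(x in B) dg A x.
Proof.
rewrite /dg exchange_big /=; apply: eq_bigr => x _; apply: eq_bigr => y _.
by rewrite e_sym.
Qed.

Lemma dgsumU A B : [disjoint A & B] ->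
  dgsum (A :|: B) = dgsum A + dgsum B + (\sum_(x in B) dg A x).*2.
Proof.
move=> dAB; rewrite /dgsum (eq_bigr (fun v => dg A v + dg B v)); last first.
  by move=> v _; rewrite dgU.
rewrite big_split /= !sum_setU // (sum_dgC A B); clear; lia.
Qed.

Lemma dgsum0 : dgsum set0 = 0.
Proof. exact: big_set0. Qed.

Lemma dgsum1 x : dgsum [set x] = 0.
Proof. by rewrite /dgsum big_set1 dg1 e_irr. Qed.

Lemma dgsumU1 x A : x \notin A -> dgsum (x |: A) = dgsum A + (dg A x).*2.
Proof.
move=> xA; have dxA : [disjoint [set x] & A] by rewrite disjoints1.
by rewrite dgsumU // dgsum1 -(sum_dgC [set x]) big_set1.
Qed.

Lemma forestS A B : A \subset B -> forest B -> forest A.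
Proof. by move=> sAB fB C sCA; apply: fB; apply: subset_trans sAB. Qed.

(** Removing a leaf lowers [dgsum] by at most 2 and [#|A|.*2] by exactly 2. *)
Lemma forest_dgsum A : forest A -> A != set0 -> dgsum A + 2 <= #|A|.*2.
Proof.
move: {2}#|A| (leqnn #|A|) => n; elim: n A => [|n IHn] A.
  by rewrite leqn0 cards_eq0 => /eqP -> _; rewrite eqxx.
move=> leAn fA A0; have [v vA dv] := fA A (subxx A) A0.
have vAv : v \notin A :\ v by rewrite !inE eqxx.
have dv' : dg (A :\ v) v <= 1 by apply: leq_trans dv; apply/dgS/subD1set.
rewrite -(setD1K vA) dgsumU1 // cardsU1 vAv.
have [->|Av0] := eqVneq (A :\ v) set0.
  by rewrite dg0 /dgsum big_set0 cards0.
have := IHn (A :\ v); rewrite (cardsD1 v) vA in leAn.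
move=> /(_ leAn (forestS (subD1set _ _) fA) Av0); move: dv'; clear; lia.
Qed.

(** If all degrees inside [B] were at least 2, their sum would reach [#|B|.*2]. *)
Lemma dgsum_forest A :
  (forall B, B \subset A -> B != set0 -> dgsum B + 2 <= #|B|.*2) -> forest A.
Proof.
move=> H B sBA B0; have := H B sBA B0.
have [/exists_inP [v vB dv] _|] := boolP [exists v in B, dg B v <= 1].
  by exists v.
rewrite negb_exists_in => /forall_inP dB.
have : #|B|.*2 <= dgsum B; last by lia.
rewrite -muln2 -sum_nat_const; apply: leq_sum => v vB.
by rewrite ltnNge dB.
Qed.

(** The path is prolonged at its head [x] by a neighbour different from the preceding vertex, which
    either is new or closes a cycle. *)
Lemma long_path_or_cycle B n :
  B != set0 -> (forall v, v \in B -> 1 < dg B v) ->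
  (exists x p, [/\ size p = n, path e x p, uniq (x :: p) & {subset x :: p <= B}]) \/
  (exists c, [/\ 2 < size c, ucycle e c & {subset c <= B}]).
Proof.
move=> /set0Pn [x0 x0B] dB; elim: n => [|n [[x [p [sp pp up sub]]]|]]; last by right.
  by left; exists x0, [::]; split=> // y; rewrite inE => /eqP ->.
have xB : x \in B by apply: sub; rewrite mem_head.
(* If [p] is empty, the default [x] excludes nothing, since [x] is not its own neighbour. Otherwise
   avoiding the head of [p] ensures that a cycle closed by [y] has at least 3 vertices. *)
have [y [yB exy yp]] := dg_gt1_exists (head x p) (dB x xB).
have yx : y != x by apply: contraTneq exy => ->; rewrite e_irr.
have [yip|ynp] := boolP (y \in p).
  right; case/splitPr: yip pp up sub yp => p1 p2.
  rewrite cat_path /= => /andP [pp1 /andP [lp1 _]] up sub yp.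
  exists (x :: rcons p1 y); split.
  - case: p1 yp {pp1 lp1 up sub} => [|a p1] /=; first by rewrite eqxx.
    by rewrite size_rcons.
  - rewrite /ucycle /= !rcons_path pp1 lp1 last_rcons e_sym exy /=.
    move: up; rewrite -cat_rcons /= cat_uniq mem_cat negb_or.
    by case/andP => /andP [-> _] /andP [-> _].
  - move=> z; rewrite inE mem_rcons => zin; apply: sub.
    rewrite inE mem_cat; move: zin; rewrite !inE.
    by case/or3P => ->; rewrite ?orbT.
left; exists y, (x :: p); split=> /=.
- by rewrite sp.
- by rewrite e_sym exy.
- by rewrite inE negb_or yx ynp.
- by move=> z; rewrite inE => /orP [/eqP ->//|]; apply: sub.
Qed.

Lemma dg2_cycle B : B != set0 -> (forall v, v \in B -> 1 < dg B v) ->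
  exists c, [/\ 2 < size c, ucycle e c & {subset c <= B}].
Proof.
move=> B0 dB; have [[x [p [sp _ up _]]]|//] := long_path_or_cycle #|T| B0 dB.
by have := max_card (mem (x :: p)); rewrite (card_uniqP up) /= sp ltnn.
Qed.

Lemma cycle_dg2 c v : 2 < size c -> ucycle e c -> v \in c ->
  1 < dg [set x in c] v.
Proof.
move=> sc /andP [cc uc] vc; have [i s cE] := rot_to vc.
have: 2 < size (v :: s) by rewrite -cE size_rot.
have: cycle e (v :: s) by rewrite -cE rot_cycle.
have: uniq (v :: s) by rewrite -cE rot_uniq.
have sc' : {subset s <= [set x in c]}.
  by move=> x xs; rewrite inE -(mem_rot i) cE inE xs orbT.
case: s sc' {cE} => // a s sc'; case/lastP: s sc' => // s b sc' us.
rewrite /= rcons_path last_rcons => /andP [eva /andP [_ ebv]] _.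
apply: (@dg_ge2 _ _ a b) => //; last by rewrite e_sym.
- by apply: sc'; rewrite mem_head.
- by apply: sc'; rewrite inE mem_rcons mem_head orbT.
- move: us => /= /and3P [_ + _]; rewrite mem_rcons inE negb_or.
  by case/andP.
Qed.

Lemma acyclic_induced A : acyclic (@induced T e A) <-> forest A.
Proof.
split=> [acA B sBA B0|fA c sc /andP [cc uc]].
  have [/exists_inP//|] := boolP [exists v in B, dg B v <= 1].
  rewrite negb_exists_in => /forall_inP dB; exfalso.
  have [v vB|c [sc /andP [cc uc] cB]] := dg2_cycle B0.
    by rewrite ltnNge dB.
  have lift : exists c' : seq {x | x \in A}, map val c' = c.
    have: {subset c <= A} by move=> x /cB; apply: (subsetP sBA).
    elim: (c) => [|x s IHs] sub; first by exists [::].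
    case: IHs => [y ys|s' <-]; first by apply: sub; rewrite inE ys orbT.
    by exists (exist _ x (sub x (mem_head _ _)) :: s').
  case: lift => c' c'E; apply: (acA c'); first by rewrite -(size_map val) c'E.
  apply/andP; split; last by rewrite -(map_inj_uniq val_inj) c'E.
  by move: cc; rewrite -c'E cycle_map.
have sc' : 2 < size (map val c) by rewrite size_map.
have uc' : ucycle e (map val c).
  by rewrite /ucycle cycle_map cc map_inj_uniq //; exact: val_inj.
have [||v vc dv] := fA [set x in map val c].
- apply/subsetP=> x; rewrite inE => /mapP [y _ ->]; exact: valP.
- case: (c) sc => // y s _; apply/set0Pn; exists (val y).
  by rewrite inE mem_head.
have vc' : v \in map val c by rewrite inE in vc.
by have := cycle_dg2 sc' uc' vc'; rewrite ltnNge dv.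
Qed.

(** Only removals of single vertices matter, because subsets of forests are forests. *)
Lemma minimal_fvsP S : minimal_fvs e S <->
  forest (~: S) /\ forall v, v \in S -> ~ forest (v |: ~: S).
Proof.
rewrite /minimal_fvs /fvs acyclic_induced; split=> -[fS mS]; split=> //.
  move=> v vS fvS; apply: (mS (S :\ v)); first by rewrite properD1.
  rewrite acyclic_induced; congr forest: fvS.
  by apply/setP=> x; rewrite !inE negb_and negbK.
move=> S' /properP [sS' [v vS vS']]; rewrite acyclic_induced => fS'.
apply: (mS v vS); apply: forestS fS'.
by rewrite subUset sub1set inE vS' setCS.
Qed.

End Forests.

(** * Labelling the trees of a forest from their roots *)

Section Labelling.
Variables (T : finType) (e : rel T).
Hypotheses (e_sym : symmetric e) (e_irr : irreflexive e).
Implicit Types (A B C D F M R S U W Y Z tm : {set T}) (a b u v w x y z : T).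
Implicit Types (L : bool -> {set T}).
Local Notation dg := (dg e).
Local Notation dgsum := (dgsum e).
Local Notation forest := (forest e).

(* [W] remains a forest when the vertices of [R] are identified. *)
Definition separated R W :=
  forall B, B \subset W -> dgsum B + #|R :&: B|.*2 <= #|B|.*2.

(* The trees of [W] met so far are rooted at [R], a subset of [tm]; a vertex has
   the label of its parent, flipped if the vertex is in [tm], and [L p] is the set
   of the vertices labelled [p]. *)
Record labelled W tm (L : bool -> {set T}) R : Prop := {
  lab_disj : [disjoint L true & L false];
  lab_sub : forall p, L p \subset W;
  lab_roots : R \subset tm :&: (L true :|: L false);
  lab_sep : separated R W;
  lab_edges : #|L true :|: L false|.*2 <= dgsum (L true :|: L false) + #|R|.*2;
  lab_built : forall p, #|L p|.*2 <= dgsum (L p) + #|tm :&: L p|.*2;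
  lab_forest : forall p, separated tm (L p);
  lab_nbr : forall p x, x \in L p -> x \in tm -> x \notin R ->
    0 < dg (L (~~ p)) x }.

Lemma lab_setU (L : bool -> {set T}) p :
  L p :|: L (~~ p) = L true :|: L false.
Proof. by case: p => //=; rewrite setUC. Qed.

Lemma lab_disj_neg (L : bool -> {set T}) p : [disjoint L true & L false] ->
  [disjoint L p & L (~~ p)].
Proof. by case: p => //=; rewrite disjoint_sym. Qed.

Lemma dgsum_le_forest A : forest A -> dgsum A <= #|A|.*2.
Proof.
move=> fA; have [->|A0] := eqVneq A set0; first by rewrite dgsum0.
by have := forest_dgsum e_sym e_irr fA A0; clear; lia.
Qed.

Lemma cardsIU1 x A B : x \notin B ->
  #|A :&: (x |: B)| = (x \in A) + #|A :&: B|.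
Proof.
move=> xB; rewrite setIUr; have [xA|xA] := boolP (x \in A).
  by rewrite (setIidPr _) ?sub1set // cardsU1 !inE (negPf xB) andbF.
have -> : A :&: [set x] = set0.
  apply/setP=> y; rewrite !inE.
  by case: eqP => [->|]; rewrite ?(negPf xA) ?andbF.
by rewrite set0U.
Qed.

Lemma separatedU1 x R W : x \notin W -> separated R W ->
  (forall B, B \subset W -> dg B x + (x \in R) <= 1) ->
  separated R (x |: W).
Proof.
move=> xW sepW dgx B sB; have [xB|xB] := boolP (x \in B); last first.
  apply: sepW; apply/subsetP=> y yB; have := subsetP sB y yB.
  by rewrite !inE => /orP [/eqP yx|//]; rewrite -yx yB in xB.
have sB' : B :\ x \subset W by rewrite subDset.
have xB' : x \notin B :\ x by rewrite !inE eqxx.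
have := sepW _ sB'; have := dgx _ sB'.
have -> : dgsum B = dgsum (x |: B :\ x) by rewrite setD1K.
have -> : #|R :&: B| = #|R :&: (x |: B :\ x)| by rewrite setD1K.
rewrite dgsumU1 // cardsIU1 // (cardsD1 x B) xB; clear; lia.
Qed.

Lemma labelled0 W tm : forest W -> labelled W tm (fun=> set0) set0.
Proof.
move=> fW; split.
- by rewrite -setI_eq0 set0I.
- by move=> p; rewrite sub0set.
- exact: sub0set.
- by move=> B sB; rewrite set0I cards0 addn0 dgsum_le_forest //; apply: forestS fW.
- by rewrite setU0 cards0.
- by move=> p; rewrite cards0.
- by move=> p B; rewrite subset0 => /eqP ->; rewrite setI0 dgsum0 cards0.
- by move=> p x; rewrite inE.
Qed.

(* The tree edges already account for all edges among labelled vertices, so a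
   new vertex is adjacent to only one of them. *)
Lemma labelled_dg1 W tm L R x : labelled W tm L R -> x \in W ->
  x \notin L true :|: L false -> dg (L true :|: L false) x <= 1.
Proof.
move=> lab xW xL.
have sL : L true :|: L false \subset W by rewrite subUset !(lab_sub lab).
have := lab_sep lab (_ : x |: (L true :|: L false) \subset W).
rewrite subUset sub1set xW sL => /(_ isT).
have sR : R \subset L true :|: L false.
  by apply: subset_trans (lab_roots lab) _; exact: subsetIr.
have -> : R :&: (x |: (L true :|: L false)) = R.
  by apply/setIidPl; apply: subset_trans sR _; exact: subsetUr.
have := lab_edges lab; rewrite dgsumU1 // cardsU1 xL; clear; lia.
Qed.

(** By [labelled_dg1], [y] is the only labelled neighbour of [x]. If [x] is not in [tm], it joins
    the class of [y] as a leaf; if it is, it opens a new piece of the other class, in which it has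
    no neighbour. *)
Lemma labelled_step W tm L R L' x y p : labelled W tm L R -> x \in W ->
  x \notin L true :|: L false -> y \in L p -> e x y ->
  L' (p (+) (x \in tm)) = x |: L (p (+) (x \in tm)) ->
  L' (~~ (p (+) (x \in tm))) = L (~~ (p (+) (x \in tm))) ->
  labelled W tm L' R.
Proof.
move=> lab xW xL yL exy; set q := p (+) (x \in tm) => L'q L'Nq.
have LLE : L' true :|: L' false = x |: (L true :|: L false).
  by rewrite -(lab_setU L' q) L'q L'Nq -setUA lab_setU.
have dx1 : dg (L true :|: L false) x = 1.
  apply/eqP; rewrite eqn_leq (labelled_dg1 lab) //=; apply: dg_ge1 exy.
  by rewrite -(lab_setU L p) inE yL.
have dxp : 0 < dg (L p) x by exact: dg_ge1 exy.
have dxNp : dg (L (~~ p)) x = 0.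
  have := dgU e x (lab_disj_neg p (lab_disj lab)).
  by rewrite lab_setU dx1; move: dxp; clear; lia.
have xLp r : x \notin L r.
  by move: xL; rewrite inE negb_or; case: r => /andP [].
have eqL' r : L' r = if r == q then x |: L r else L r.
  case: eqP => [->//|/eqP rq]; have -> : r = ~~ q by case: (r) (q) rq => [] [].
  by [].
split.
- have: [disjoint L' q & L' (~~ q)].
    rewrite L'q L'Nq disjoints_subset subUset sub1set inE xLp.
    by rewrite -disjoints_subset lab_disj_neg // (lab_disj lab).
  by case: (q) => //=; rewrite disjoint_sym.
- move=> r; rewrite eqL'; case: eqP => _; last exact: (lab_sub lab).
  by rewrite subUset sub1set xW (lab_sub lab).
- apply: subset_trans (lab_roots lab) _; rewrite LLE; apply: setIS.
  exact: subsetUr.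
- exact: (lab_sep lab).
- rewrite LLE dgsumU1 // cardsU1 xL dx1; have := lab_edges lab; clear; lia.
- move=> r; rewrite eqL'; case: eqP => [->|_]; last exact: (lab_built lab).
  rewrite dgsumU1 // cardsU1 xLp cardsIU1 //; have := lab_built lab q.
  by move: dxp; rewrite /q; case: (x \in tm); rewrite ?addbF ?addbT; clear; lia.
- move=> r; rewrite eqL'; case: eqP => [->|_]; last exact: (lab_forest lab).
  apply: separatedU1 (xLp _) _ _; first exact: (lab_forest lab).
  move=> B sB.
  have := dgS e x sB; move: dx1 dxNp; rewrite -(lab_setU L p) dgU; last first.
    exact/lab_disj_neg/(lab_disj lab).
  by rewrite /q; case: (x \in tm); rewrite ?addbF ?addbT /=; clear; lia.
- move=> r z; rewrite (eqL' r) => zL ztm zR.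
  have [zx|zx] := eqVneq z x; last first.
    have zLr : z \in L r by move: zL; case: eqP => // _; rewrite !inE (negPf zx).
    apply: leq_trans (lab_nbr lab zLr ztm zR) (dgS _ _ _).
    by rewrite eqL'; case: eqP => // _; exact: subsetUr.
  subst z; have rq : r = q.
    by apply/eqP; move: zL; case: eqP => // _; rewrite (negPf (xLp _)).
  by rewrite rq L'Nq; move: dxp; rewrite /q ztm addbT negbK.
Qed.

(** Since the labelled set is closed under adjacency in [W], no edge joins the labelled part of a
    set [B] to the rest of it. If [B] contains [x], that rest is a nonempty forest, and the 2 to
    spare in [forest_dgsum] pays for the new root. *)
Lemma labelled_root W tm L R L' x : forest W -> tm \subset W ->
  labelled W tm L R -> x \in tm -> x \notin L true :|: L false ->
  (forall y z, y \in L true :|: L false -> z \in W -> e y z ->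
     z \in L true :|: L false) ->
  L' true = x |: L true -> L' false = L false ->
  labelled W tm L' (x |: R).
Proof.
move=> fW stW lab xtm xL closed L't L'f; set LL := L true :|: L false.
have xW : x \in W := subsetP stW x xtm.
have LLE : L' true :|: L' false = x |: LL by rewrite L't L'f setUA.
have sL : LL \subset W by rewrite subUset !(lab_sub lab).
have sR : R \subset LL.
  by apply: subset_trans (lab_roots lab) _; exact: subsetIr.
have dLL z : z \in W -> z \notin LL -> dg LL z = 0.
  move=> zW; apply: contraNeq; rewrite -lt0n => /dg_gt0P [y yL ezy].
  by apply: closed yL zW _; rewrite e_sym.
have xLp r : x \notin L r.
  by move: xL; rewrite inE negb_or; case: r => /andP [].
have dx r : dg (L r) x = 0.
  apply/eqP; rewrite -leqn0 -(dLL x xW xL); apply: dgS.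
  by rewrite /LL -(lab_setU L r) subsetUl.
have eqL' r : L' r = if r then x |: L r else L r by case: r.
split.
- rewrite L't L'f disjoints_subset subUset sub1set inE xLp.
  by rewrite -disjoints_subset (lab_disj lab).
- move=> r; rewrite eqL'; case: (r); last exact: (lab_sub lab).
  by rewrite subUset sub1set xW (lab_sub lab).
- rewrite LLE subUset sub1set !inE eqxx xtm /=.
  apply: subset_trans (lab_roots lab) _; apply: setIS; exact: subsetUr.
- move=> B sB; have dB : [disjoint B :&: LL & B :\: LL].
    by rewrite -setI_eq0 setIDA setIC setIA -setIDA setDv setI0.
  have BE : B = (B :&: LL) :|: (B :\: LL) by rewrite setID.
  have cut : \sum_(z in B :\: LL) dg (B :&: LL) z = 0.
    apply: big1 => z; rewrite inE => /andP [zL zB]; apply/eqP.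
    rewrite -leqn0 -(dLL z (subsetP sB z zB) zL).
    exact/dgS/subsetIr.
  have fB : forest (B :\: LL).
    by apply: forestS fW; apply: subset_trans sB; exact: subsetDl.
  have sepB := lab_sep lab (subset_trans (subsetIl B LL) sB).
  have RB : R :&: (B :&: LL) = R :&: B.
    by rewrite setIA setIAC (setIidPl sR).
  rewrite RB in sepB.
  have cB : #|B| = #|B :&: LL| + #|B :\: LL| by rewrite cardsID.
  have eB : dgsum B = dgsum (B :&: LL) + dgsum (B :\: LL).
    by rewrite {1}BE dgsumU // cut addn0.
  have xR : x \notin R by apply: contra xL; exact: (subsetP sR).
  have [xB|xB] := boolP (x \in B); last first.
    have -> : (x |: R) :&: B = R :&: B.
      apply/setP=> z; rewrite !inE; case: eqP => //= ->.
      by rewrite (negPf xB) andbF.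
    have := dgsum_le_forest fB; rewrite eB cB; move: sepB; clear; lia.
  have xBL : B :\: LL != set0 by apply/set0Pn; exists x; rewrite inE xL.
  have := forest_dgsum e_sym e_irr fB xBL.
  have -> : #|(x |: R) :&: B| = #|R :&: B|.+1.
    have -> : (x |: R) :&: B = x |: (R :&: B).
      by apply/setP=> z; rewrite !inE; case: eqP => //= ->; rewrite xB.
    by rewrite cardsU1 !inE (negPf xR).
  rewrite eB cB; move: sepB; clear; lia.
- have xR : x \notin R by apply: contra xL; exact: (subsetP sR).
  rewrite LLE dgsumU1 // !cardsU1 xL xR (dLL x xW xL).
  by have := lab_edges lab; rewrite -/LL; clear; lia.
- move=> r; rewrite eqL'; case: (r); last exact: (lab_built lab).
  rewrite dgsumU1 // cardsU1 xLp cardsIU1 // xtm; have := lab_built lab true; clear; lia.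
- move=> r; rewrite eqL'; case: (r); last exact: (lab_forest lab).
  apply: separatedU1 (xLp _) _ _; first exact: (lab_forest lab).
  move=> B sB.
  by have := dgS e x sB; rewrite dx xtm; clear; lia.
- move=> r z; rewrite (eqL' r) inE negb_or inE => zL ztm /andP [zx zR].
  have zLr : z \in L r by move: zL; case: (r) => //; rewrite !inE (negPf zx).
  apply: leq_trans (lab_nbr lab zLr ztm zR) (dgS _ _ _).
  by rewrite eqL'; case: (~~ r) => //; exact: subsetUr.
Qed.

End Labelling.

(** * Pairs of vertices outside a forest and the vertices they serve *)

Section Pairs.
Variables (T : finType) (e : rel T).
Hypotheses (e_sym : symmetric e) (e_irr : irreflexive e).
Implicit Types (A B C D F Fs M Q R S U W Y Z tm : {set T}) (a b u v w x y z : T).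
Implicit Types (L : bool -> {set T}).
Local Notation dg := (dg e).
Local Notation dgsum := (dgsum e).
Local Notation forest := (forest e).

Lemma disjoint_setUl A B C :
  [disjoint A :|: B & C] = [disjoint A & C] && [disjoint B & C].
Proof. by rewrite !disjoints_subset subUset. Qed.

Lemma dg_nbrs A B v : (forall z, z \in A -> e v z -> z \in B) -> dg A v <= dg B v.
Proof.
move=> sAB; rewrite /dg (bigID (mem B)) /= [X in _ + X]big1 ?addn0; last first.
  by move=> z /andP [zA]; apply: contraNeq; rewrite eqb0 negbK; exact: sAB.
rewrite big_mkcondl /= [leqRHS](bigID (mem A)) /= -big_mkcondl.
by under eq_bigl do rewrite andbC; exact: leq_addr.
Qed.

Definition single F U := [set x in F | dg U x <= 1].
Definition terminals F U := [set x in F | dg U x == 1].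
Definition double F U := [set x in F | 1 < dg U x].

Lemma single_sub F U : single F U \subset F.
Proof. by apply/subsetP=> x; rewrite inE => /andP []. Qed.

Lemma terminals_sub F U : terminals F U \subset single F U.
Proof. by apply/subsetP=> x; rewrite !inE => /andP [-> /eqP ->]. Qed.

Lemma sum_dg_terminals F U A : A \subset single F U ->
  \sum_(x in A) dg U x = #|terminals F U :&: A|.
Proof.
move=> sA; rewrite -sum1_card big_mkcond [RHS]big_mkcond /=.
apply: eq_bigr => x _; rewrite !inE; case: (boolP (x \in A)) => xA; last by rewrite andbF.
move: (subsetP sA x xA); rewrite inE => /andP [-> /=].
by case: (dg U x) => [|[|]].
Qed.

(** An edge from [U] to [L p] ends in a terminal, one edge per terminal, and [lab_forest] has
    already set aside its contribution. The missing 2 comes from [B :&: U] if this is nonempty;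
    otherwise [B] lies inside the forest [F]. *)
Lemma labelled_forestU F U L R p : forest F -> [disjoint U & F] ->
  forest U -> labelled e (single F U) (terminals F U) L R ->
  forest (U :|: L p).
Proof.
move=> fF dUF fU lab; apply: dgsum_forest => B sB B0.
have sL : L p \subset F := subset_trans (lab_sub lab p) (single_sub F U).
have BE : B = (B :&: U) :|: (B :&: L p) by rewrite -setIUr (setIidPl sB).
have dis : [disjoint B :&: U & B :&: L p].
  apply: disjointWl (subsetIr _ _) _; apply: disjointWr (subsetIr _ _) _.
  exact: disjointWr sL dUF.
have cB : #|B| = #|B :&: U| + #|B :&: L p|.
  by rewrite {1}BE cardsU (disjoint_setI0 dis) cards0 subn0.
have sBL : B :&: L p \subset single F U.
  exact: subset_trans (subsetIr _ _) (lab_sub lab p).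
have cut : \sum_(x in B :&: L p) dg (B :&: U) x <= #|terminals F U :&: (B :&: L p)|.
  rewrite -sum_dg_terminals //; apply: leq_sum => x _; apply: dgS; exact: subsetIr.
have eB : dgsum B = dgsum (B :&: U) + dgsum (B :&: L p)
    + (\sum_(x in B :&: L p) dg (B :&: U) x).*2 by rewrite {1}BE dgsumU.
have := lab_forest lab (subsetIr B (L p)).
rewrite eB cB.
have fBU : forest (B :&: U) := forestS (subsetIr _ _) fU.
have fBL : forest (B :&: L p) := forestS (subset_trans (subsetIr _ _) sL) fF.
have [BU0|BU0] := eqVneq (B :&: U) set0; last first.
  by have := forest_dgsum e_sym e_irr fBU BU0; move: cut; clear; lia.
have BL0 : B :&: L p != set0 by move: B0; rewrite {1}BE BU0 set0U.
have := forest_dgsum e_sym e_irr fBL BL0.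
have -> : \sum_(x in B :&: L p) dg (B :&: U) x = 0.
  by apply: big1 => x _; rewrite BU0 dg0.
rewrite BU0 cards0 dgsum0; clear; lia.
Qed.

(* Every vertex of [L p] has an edge to its parent or to [U], and every vertex
   counted on the left has two edges to [U :|: L p]; two of them in [M] would
   give too many edges for a forest. *)
Lemma forest_avoids F U L R M p : [disjoint U & F] -> U != set0 -> #|U| <= 2 ->
  labelled e (single F U) (terminals F U) L R ->
  forest M -> U :|: L p \subset M ->
  #|double F U| + #|(terminals F U :\: R) :&: L (~~ p)| <= #|~: M| + 1.
Proof.
move=> dUF U0 cU lab fM sM.
set N := _ :&: L (~~ p); set X := double F U :|: N.
have sLF q : L q \subset single F U := lab_sub lab q.
have sNF : N \subset single F U by apply: subset_trans (sLF (~~ p)); exact: subsetIr.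
have dDL A : A \subset single F U -> [disjoint double F U & A].
  move=> sA; apply: disjointWr sA _; rewrite -setI_eq0; apply/eqP/setP=> x.
  by rewrite !inE; case: (x \in F) => //=; lia.
have cX : #|X| = #|double F U| + #|N|.
  by rewrite cardsU (disjoint_setI0 (dDL _ sNF)) cards0 subn0.
have sXF : X \subset F.
  rewrite subUset (subset_trans sNF (single_sub F U)) andbT.
  by apply/subsetP=> x; rewrite inE => /andP [].
have dXL : [disjoint L p & X].
  rewrite disjoint_sym disjoint_setUl dDL //= disjoint_sym.
  apply: disjointWr (subsetIr _ _) _.
  exact/lab_disj_neg/(lab_disj lab).
have dX x : x \in X -> 2 <= dg (U :|: L p) x.
  rewrite dgU; last by apply: disjointWr (subset_trans (sLF p) (single_sub F U)) dUF.
  rewrite in_setU => /orP [|xN]; first by rewrite inE => /andP [_]; clear; lia.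
  move: (xN); rewrite inE in_setD => /andP [/andP [xR xt] xL].
  have := lab_nbr lab xL xt xR; rewrite negbK.
  by move: xt; rewrite inE => /andP [_ /eqP ->]; clear; lia.
have sL : L p \subset F := subset_trans (sLF p) (single_sub F U).
have dUL : [disjoint U & L p] := disjointWr sL dUF.
suff : #|M :&: X| <= 1.
  have := cardsID M X; rewrite setIC cX setDE.
  have : #|X :&: ~: M| <= #|~: M| by apply/subset_leq_card/subsetIr.
  clear; lia.
set Y := M :&: X; pose B := (U :|: L p) :|: Y.
have dB : [disjoint U :|: L p & Y].
  rewrite disjoint_setUl (disjointWr (subsetIr _ _) dXL) andbT.
  apply: disjointWr (subsetIr _ _) _; exact: disjointWr sXF dUF.
have fB : forest B by apply: forestS fM; rewrite subUset sM subsetIl.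
have B0 : B != set0 by rewrite -!subset0 !subUset !subset0 (negPf U0).
have := forest_dgsum e_sym e_irr fB B0.
rewrite !dgsumU // /B !cardsU (disjoint_setI0 dB) (disjoint_setI0 dUL) !cards0 !subn0.
have := lab_built lab p; rewrite (@sum_dg_terminals F) //.
have : #|Y| * 2 <= \sum_(x in Y) dg (U :|: L p) x.
  by rewrite -sum_nat_const; apply: leq_sum => x; rewrite inE => /andP [_ /dX].
move: cU; clear; lia.
Qed.

(** Each forest avoids all but one of its unwanted vertices. These include [double F U] in both
    cases, while the terminals outside [R] are shared out according to their labels. *)
Lemma two_forests F U L R M1 M2 : [disjoint U & F] -> U != set0 -> #|U| <= 2 ->
  labelled e (single F U) (terminals F U) L R ->
  terminals F U \subset L true :|: L false ->
  forest M1 -> U :|: L true \subset M1 ->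
  forest M2 -> U :|: L false \subset M2 ->
  #|double F U| + #|terminals F U :\: R| <= #|~: M1| + #|~: M2| + 2.
Proof.
move=> dUF U0 cU lab st fM1 sM1 fM2 sM2.
have := forest_avoids dUF U0 cU lab fM1 sM1.
have := forest_avoids dUF U0 cU lab fM2 sM2.
set N := _ :\: R => /= H2 H1.
have : #|N| <= #|N :&: L true| + #|N :&: L false|.
  rewrite -cardsUI -setIUr (setIidPl _) ?leq_addr //.
  exact: subset_trans (subsetDl _ _) st.
move: H1 H2; clear; lia.
Qed.

Lemma forest_card_le2 U : #|U| <= 2 -> forest U.
Proof.
move=> cU B sBU /set0Pn [v vB]; exists v => //.
apply: leq_trans (dg_nbrs (B := U :\ v) _) (dg_le _ _ _).
  move=> z zB evz; rewrite !inE (subsetP sBU) // andbT.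
  by apply: contraTneq evz => ->; rewrite e_irr.
by have := cardsD1 v U; rewrite (subsetP sBU) //; move: cU; clear; lia.
Qed.

(** * Reachability inside a set of vertices *)

Definition closedin W C :=
  [forall x in C, forall y in W, e x y ==> (y \in C)].

(** The union of the components of [W] that meet [Z], taken as the least closed set containing the
    seeds, so that closure and minimality are immediate and no walks appear. *)
Definition reach W Z := [set x in W | [forall C : {set T},
  (Z :&: W \subset C) && closedin W C ==> (x \in C)]].

Lemma closedinP W C :
  reflect {in C & W, forall x y, e x y -> y \in C} (closedin W C).
Proof.
apply: (iffP forall_inP) => [H x y xC yW exy|H x xC].
  by have /forall_inP /(_ y yW) /implyP := H x xC; apply.
by apply/forall_inP => y yW; apply/implyP; exact: H.
Qed.

Lemma reach_sub W Z : reach W Z \subset W.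
Proof. by apply/subsetP=> x; rewrite inE => /andP []. Qed.

Lemma reach_seed W Z : Z :&: W \subset reach W Z.
Proof.
apply/subsetP=> x xZW; rewrite inE; move: (xZW); rewrite inE => /andP [_ ->] /=.
by apply/forallP=> C; apply/implyP => /andP [/subsetP/(_ x xZW)].
Qed.

Lemma reach_closed W Z : {in reach W Z & W, forall x y, e x y -> y \in reach W Z}.
Proof.
move=> x y; rewrite [x \in _]inE => /andP [_ /forallP xC] yW exy; rewrite inE yW /=.
apply/forallP=> C; apply/implyP => CP; have /implyP/(_ CP) := xC C.
by case/andP: CP => _ /closedinP CP xC'; exact: CP exy.
Qed.

Lemma reach_min W Z C : Z :&: W \subset C ->
  {in C & W, forall x y, e x y -> y \in C} -> reach W Z \subset C.
Proof.
move=> sC cC; apply/subsetP=> x; rewrite inE => /andP [_ /forallP/(_ C)/implyP].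
by apply; rewrite sC; apply/closedinP.
Qed.

Lemma reach_mono W Z Z' : Z :&: W \subset Z' -> reach W Z \subset reach W Z'.
Proof.
move=> sZ; apply: reach_min; last exact: reach_closed.
by apply: subset_trans (reach_seed _ _); rewrite subsetI sZ subsetIr.
Qed.

(** A walk in [W] starting in [Z] avoids [D], or else its end is reached from the last visit to
    [D]. *)
Lemma reach_split W Z D :
  reach W Z \subset reach (W :\: D) Z :|: reach W D.
Proof.
have seedD y : y \in W -> y \in D -> y \in reach W D.
  by move=> yW yD; apply: (subsetP (reach_seed W D)); rewrite inE yD.
apply: reach_min => [|x y].
  apply/subsetP=> z; rewrite inE => /andP [zZ zW]; rewrite inE.
  have [zD|zD] := boolP (z \in D); first by rewrite (seedD z) ?orbT.
  by rewrite (subsetP (reach_seed _ _)) // !inE zZ zD.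
rewrite inE => xC yW exy; rewrite inE.
have [yD|yD] := boolP (y \in D); first by rewrite (seedD y) ?orbT.
case/orP: xC => xC.
  by rewrite (reach_closed xC _ exy) // inE yD.
by rewrite (reach_closed xC _ exy) ?orbT.
Qed.

(** By symmetry of [e], the part of [W] outside [reach W Z] is closed as well, so it would contain
    everything reached from [a]. *)
Lemma reach_back W Z a x : a \in W -> x \in reach W [set a] -> x \in Z ->
  a \in reach W Z.
Proof.
move=> aW xa xZ; apply: contraLR isT => aZ.
suff /subsetP/(_ x xa) : reach W [set a] \subset W :\: reach W Z.
  rewrite inE => /andP [/negP xr xW]; case: xr.
  by apply: (subsetP (reach_seed _ _)); rewrite inE xZ.
apply: reach_min => [|y z].
  apply/subsetP=> y; rewrite in_setI in_set1 => /andP [/eqP -> _].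
  by rewrite in_setD aZ.
rewrite in_setD => /andP [yr yW] zW eyz; rewrite in_setD zW andbT.
by apply: contra yr => zr; apply: reach_closed zr yW _; rewrite e_sym.
Qed.

(** In order of discovery, every vertex outside [Z] has an edge to an earlier one. A largest subset
    satisfying the inequality replaces this order: any seed or neighbour could still be added to
    it. *)
Lemma reach_built W Z : #|reach W Z|.*2 <= dgsum (reach W Z) + #|Z :&: reach W Z|.*2.
Proof.
set Y := reach W Z.
pose built B := (B \subset Y) && (#|B|.*2 <= dgsum B + #|Z :&: B|.*2).
have b0 : built set0 by rewrite /built sub0set cards0.
case: (arg_maxnP (fun B => #|B|) b0) => B /andP [sB bB] maxB.
have grow x : x \in Y -> x \notin B -> (x \in Z) || (0 < dg B x) -> False.
  move=> xY xB xP; suff /maxB : built (x |: B) by rewrite cardsU1 xB; lia.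
  rewrite /built subUset sub1set xY sB dgsumU1 // cardsU1 xB cardsIU1 //.
  by move: bB xP; case: (x \in Z) => /=; clear; lia.
suff -> : Y = B by [].
apply/eqP; rewrite eqEsubset sB andbT; apply: reach_min => [|x y xB yW exy].
  apply/subsetP=> z zZW; apply/negPn/negP => zB.
  have zY := subsetP (reach_seed W Z) z zZW.
  by apply: (grow z zY zB); move: zZW; rewrite inE => /andP [->].
apply/negPn/negP => yB; have yY := reach_closed (subsetP sB x xB) yW exy.
apply: (grow y yY yB); rewrite (dg_ge1 xB) ?orbT //.
by rewrite e_sym.
Qed.

(** By [bY], there is at most one piece of [Y] per terminal in it. Every [v] in [Q] merges two
    pieces, a terminal [v] counting as one itself, while elements of [R] lie in different trees of
    [W] and are never merged. So there are at most as many merges as terminals outside [R]. *)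
Lemma card_between W tm R Y Q : separated e R W -> tm \subset W -> R \subset tm ->
  Y \subset W -> #|Y|.*2 <= dgsum Y + #|tm :&: Y|.*2 ->
  Q \subset W -> [disjoint Y & Q] ->
  (forall v, v \in Q -> 2 <= (v \in tm) + dg Y v) ->
  #|Q| <= #|tm :\: R|.
Proof.
move=> sep st sR sY bY sQ dYQ dQ.
have sB : Y :|: Q \subset W by rewrite subUset sY.
have := sep _ sB; rewrite dgsumU // cardsU (disjoint_setI0 dYQ) cards0 subn0.
have : #|Q| * 2 <= #|tm :&: Q| + \sum_(v in Q) dg Y v.
  rewrite -sum_nat_const -sum1_card [X in X + _]big_mkcond [X in _ <= _ + X]big_mkcond.
  rewrite [leqLHS]big_mkcond -big_split /=; apply: leq_sum => v _.
  by rewrite inE; case: (boolP (v \in Q)) => // /dQ; rewrite andbT; case: (v \in tm).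
have dt : [disjoint tm :&: Y & tm :&: Q].
  by apply: disjointWl (subsetIr _ _) _; apply: disjointWr (subsetIr _ _) _.
have : #|tm :&: Y| + #|tm :&: Q| <= #|tm :\: R| + #|R :&: (Y :|: Q)|.
  have -> : #|tm :&: Y| + #|tm :&: Q| = #|tm :&: (Y :|: Q)|.
    by rewrite setIUr cardsU (disjoint_setI0 dt) cards0 subn0.
  apply: leq_trans (leq_card_setU _ _).1; apply: subset_leq_card.
  apply/subsetP=> x; rewrite inE => /andP [xt xB]; rewrite in_setU in_setD in_setI xt xB.
  by case: (x \in R).
move: bY; clear; lia.
Qed.

Definition nbrs u := [set x | e u x].

Lemma reach_monoW W W' Z : W \subset W' -> reach W Z \subset reach W' Z.
Proof.
move=> sW; apply: reach_min => [|x y xC yW exy].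
  by apply: subset_trans (reach_seed _ _); exact: setIS.
exact: reach_closed xC (subsetP sW y yW) exy.
Qed.

(* If [a] could not reach [Fs :\: F], its component in [B :&: Fs :&: F] would
   form, together with [v], a subset of the forest [F] with too many edges. *)
Lemma arm F Fs B v a : forest F -> v \in F -> v \notin Fs ->
  B \subset v |: Fs -> (forall x, x \in B -> 1 < dg B x) ->
  a \in B -> e v a -> a \in F ->
  exists2 u, u \in Fs :\: F & a \in reach (Fs :&: F) (nbrs u).
Proof.
move=> fF vF vFs sB dB aB eva aF; apply/exists_inP.
have av : a != v by apply: contraTneq eva => ->; rewrite e_irr.
have aFs : a \in Fs by have := subsetP sB a aB; rewrite !inE (negPf av).
apply: contraT => noarm; set W := Fs :&: F :&: B.
have aW : a \in W by rewrite !inE aFs aF.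
set C := reach W [set a]; have sC : C \subset W := reach_sub _ _.
have aC : a \in C by apply: (subsetP (reach_seed _ _)); rewrite inE aW inE eqxx.
have vC : v \notin C.
  by apply: contra vFs => /(subsetP sC); rewrite !inE -andbA => /and3P [].
have nbrC y z : y \in C -> z \in B -> e y z -> z \in v |: C.
  move=> yC zB eyz; rewrite in_setU1; have [//|zv] := eqVneq z v.
  have zFs : z \in Fs by have := subsetP sB z zB; rewrite !inE (negPf zv).
  have [zF|zF] := boolP (z \in F).
    by apply: (reach_closed yC _ eyz); rewrite !inE zFs zF.
  case/negP: noarm; apply/exists_inP; exists z; first by rewrite inE zF.
  apply: (subsetP (reach_monoW _ (subsetIl _ B))).
  by apply: reach_back aW yC _; rewrite inE e_sym.
have fvC : forest (v |: C).
  apply: forestS fF; rewrite subUset sub1set vF; apply: subset_trans sC _.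
  by rewrite /W -setIA setICA subsetIl.
have vC0 : v |: C != set0 by apply/set0Pn; exists v; rewrite setU11.
have := forest_dgsum e_sym e_irr fvC vC0; rewrite cardsU1 vC.
suff : 1 + #|C| * 2 <= dgsum (v |: C) by clear; lia.
rewrite /dgsum big_setU1 //= leq_add //.
  by apply: (dg_ge1 (y := a)); rewrite // in_setU1 aC orbT.
rewrite -sum_nat_const; apply: leq_sum => y yC.
have yB : y \in B by have := subsetP sC y yC; rewrite inE => /andP [].
by apply: leq_trans (dB y yB) _; apply: dg_nbrs => z; exact: nbrC.
Qed.

(** The vertices linked to [U] inside [Fs :&: F] without passing through [double F U]. *)
Definition tips F Fs U := reach (Fs :&: single F U) (terminals F U).

(** The vertices that [U] serves. *)
Definition between F Fs U := [set v in F :\: Fs | 1 < dg (U :|: tips F Fs U) v].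

(** A link from [a] to [u] either avoids [double F U], and then ends in a terminal, or passes
    through a vertex adjacent to both [u] and [w], and then [a] is linked to [w] too. The inequality
    [u != w] makes the second case impossible for a one-element set. *)
Lemma arm_tips F Fs u w a :
  a \in reach (Fs :&: F) (nbrs u) ->
  (a \in tips F Fs [set u; w]) || (u != w) && (a \in reach (Fs :&: F) (nbrs w)).
Proof.
set U := [set u; w] => /(subsetP (reach_split _ _ (double F U))).
rewrite inE => /orP [au|aw]; apply/orP; [left|right].
  have WE : Fs :&: F :\: double F U = Fs :&: single F U.
    apply/setP=> x; rewrite !inE.
    by case: (x \in F); rewrite ?andbF //= ?andbT -leqNgt andbC.
  rewrite WE in au; apply: (subsetP (reach_mono _) a au).
  apply/subsetP=> x; rewrite !inE => /andP [eux /andP [_ /andP [-> dx]]] /=.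
  by rewrite eqn_leq dx; apply: (dg_ge1 (y := u)); rewrite ?inE ?eqxx // e_sym.
have Dw x : x \in double F U -> (u != w) && e w x.
  rewrite inE => /andP [_] /(dg_gt1_exists u) [y []].
  by rewrite !inE => /orP [] /eqP -> exy; rewrite ?eqxx // eq_sym => ->; rewrite e_sym.
apply/andP; split; last first.
  apply: (subsetP (reach_mono _) a aw).
  by apply/subsetP=> x; rewrite in_setI => /andP [/Dw /andP [_ ewx] _]; rewrite inE.
apply: contraTneq aw => uw; suff -> : double F U = set0.
  suff /subsetP/(_ a) s0 : reach (Fs :&: F) set0 \subset set0.
    by apply/negP => /s0; rewrite inE.
  by apply: reach_min => [|x y]; rewrite ?set0I ?sub0set // inE.
by apply/setP=> x; rewrite in_set0; apply/negP => /Dw; rewrite uw eqxx.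
Qed.

Lemma card_cover (I : finType) (P : {set I}) (Q : I -> {set T}) A m :
  (forall v, v \in A -> exists2 i, i \in P & v \in Q i) ->
  (forall i, i \in P -> #|Q i| <= m) -> #|A| <= #|P| * m.
Proof.
move=> cov bnd; apply: (@leq_trans (\sum_(i in P) #|Q i|)); last first.
  by rewrite -sum_nat_const; exact: leq_sum.
apply: (@leq_trans #|\bigcup_(i in P) Q i|).
  apply/subset_leq_card/subsetP=> v /cov [i iP vQ].
  by apply/bigcupP; exists i.
elim/big_rec2: _ => [|i n B _ le_B]; first by rewrite cards0.
by apply: leq_trans (leq_card_setU _ _).1 _; rewrite leq_add2l.
Qed.

(** A set [B] of minimum degree 2 witnesses that [v |: Fs] is not a forest. Two neighbours [a] and
    [b] of [v] in [B] are then followed to vertices outside [F]. *)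
Lemma between_cover F Fs v : forest F -> forest Fs -> v \in F :\: Fs ->
  ~ forest (v |: Fs) ->
  exists2 p, p \in setX (~: F) (~: F) & v \in between F Fs [set p.1; p.2].
Proof.
move=> fF fFs vFFs nf; move: (vFFs); rewrite inE => /andP [vFs vF].
have [/existsP [B /and3P [sB B0 /forall_inP dB]]|nB] := boolP [exists B : {set T},
    [&& B \subset v |: Fs, B != set0 & [forall x in B, 1 < dg B x]]]; last first.
  case: nf => B sB B0; apply/exists_inP; apply: contraR nB => /exists_inPn dB.
  apply/existsP; exists B; rewrite sB B0; apply/forall_inP => x xB.
  by rewrite ltnNge; exact: dB.
have vB : v \in B.
  apply/negPn/negP => vB; have [|x xB] := fFs B _ B0; last by rewrite leqNgt dB.
  apply/subsetP=> x xB; have := subsetP sB x xB; rewrite !inE => /orP [/eqP xv|//].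
  by rewrite -xv xB in vB.
have [a [aB eva _]] := dg_gt1_exists v (dB v vB).
have [b [bB evb ba]] := dg_gt1_exists a (dB v vB).
pose armed u c := (c == u) || (c \in reach (Fs :&: F) (nbrs u)).
have ex_arm c : c \in B -> e v c -> exists2 u, u \in ~: F & armed u c.
  move=> cB evc; have [cF|cF] := boolP (c \in F); last first.
    by exists c; rewrite ?inE // /armed eqxx.
  have [u] := arm fF vF vFs sB dB cB evc cF.
  by rewrite inE => /andP [uF _] cu; exists u; rewrite ?inE // /armed cu orbT.
have armed_in u w c : armed u c ->
    (c \in [set u; w] :|: tips F Fs [set u; w]) || (u != w) && armed w c.
  case/orP => [/eqP ->|/(arm_tips w) /orP [ct|/andP [uw cw]]].
  - by rewrite !inE eqxx.
  - by rewrite inE ct orbT.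
  - by rewrite uw /armed cw !orbT.
have pairP u w : u \in ~: F -> w \in ~: F -> 
    a \in [set u; w] :|: tips F Fs [set u; w] ->
    b \in [set u; w] :|: tips F Fs [set u; w] ->
    exists2 p, p \in setX (~: F) (~: F) & v \in between F Fs [set p.1; p.2].
  move=> uF wF aU bU; exists (u, w); first by rewrite inE uF.
  by rewrite inE vFFs; apply: dg_ge2 bU aU ba evb eva.
have single_arm u : u \in ~: F -> armed u a -> armed u b ->
    exists2 p, p \in setX (~: F) (~: F) & v \in between F Fs [set p.1; p.2].
  move=> uF /(armed_in u u); rewrite eqxx orbF => au /(armed_in u u).
  by rewrite eqxx orbF; exact: pairP au.
have [u uF ua] := ex_arm a aB eva; have [w wF wb] := ex_arm b bB evb.
(* If the pair fails for [a], then [a] is linked to [w] just as [b] is, and [w] alone serves [v];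
   symmetrically for [b] and [u]. *)
have /orP [aU|/andP [_ wa]] := armed_in u w a ua; last exact: single_arm wa wb.
have /orP [bU|/andP [_ ub]] := armed_in w u b wb; last exact: single_arm ua ub.
rewrite (_ : [set w; u] = [set u; w]) in bU; last exact: setUC.
exact: (pairP u w).
Qed.

Lemma card_minimal_fvs_le F Fs m : forest F -> forest Fs ->
  (forall v, v \notin Fs -> ~ forest (v |: Fs)) ->
  (forall u w, u \notin F -> w \notin F -> #|between F Fs [set u; w]| <= m) ->
  #|~: Fs| <= #|~: F| + #|~: F| ^ 2 * m.
Proof.
move=> fF fFs mFs bnd.
have : #|F :\: Fs| <= #|setX (~: F) (~: F)| * m.
  apply: (card_cover (Q := fun p => between F Fs [set p.1; p.2])) => [v vF|[u w]].
    by apply: between_cover => //; apply: mFs; move: vF; rewrite inE => /andP [].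
  by rewrite !inE => /andP [uF wF]; exact: bnd.
rewrite cardsX mulnn; suff : #|~: Fs| <= #|~: F| + #|F :\: Fs| by clear; lia.
apply: leq_trans (leq_card_setU _ _).1; apply: subset_leq_card.
by apply/subsetP=> x; rewrite !inE => ->; case: (x \in F).
Qed.

Lemma card_between_le F Fs U R : separated e R (single F U) ->
  R \subset terminals F U -> [disjoint U & F] ->
  #|between F Fs U| <= #|double F U| + #|terminals F U :\: R|.
Proof.
move=> sep sR dUF; set Y := tips F Fs U.
have sYW : Y \subset single F U := subset_trans (reach_sub _ _) (subsetIr _ _).
have sYFs : Y \subset Fs := subset_trans (reach_sub _ _) (subsetIl _ _).
have dUY : [disjoint U & Y].
  exact: disjointWr (subset_trans sYW (single_sub F U)) dUF.
have Qle : #|between F Fs U :&: single F U| <= #|terminals F U :\: R|.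
  apply: (card_between sep (terminals_sub F U) sR sYW (reach_built _ _)).
  - exact: subsetIr.
  - rewrite disjoint_sym disjoints_subset; apply/subsetP=> x.
    rewrite in_setI => /andP [xQ _]; rewrite in_setC.
    have xFs : x \notin Fs.
      by move: xQ; rewrite inE in_setD => /andP [/andP []].
    by apply: contra xFs; exact: (subsetP sYFs).
  - move=> v; rewrite in_setI !inE -/Y dgU // => /andP [/andP [_ d2] /andP [-> d1]].
    by move: d1 d2; case: (dg U v) => [|[|]] /=; clear; lia.
apply: (@leq_trans #|double F U :|: (between F Fs U :&: single F U)|).
  apply/subset_leq_card/subsetP=> v vQ; rewrite in_setU in_setI vQ.
  have vF : v \in F by move: vQ; rewrite inE in_setD => /andP [/andP []].
  by rewrite !inE vF /= [dg U v <= 1]leqNgt orbN.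
by apply: leq_trans (leq_card_setU _ _).1 _; rewrite leq_add2l.
Qed.

End Pairs.

(** * The approximation algorithm *)

(* Variables: 0 and 1 are [u] and [w], 2 a potential root, 3 a round, 4 the vertex
   under consideration, 5 the index of a [Map], 6 and 7 indices of sums.
   Arrays: 0 is the forest being built, 1 a work copy of it, 2 the smallest
   maximal forest found, 3 the first one, 4 the labels: 0 for none, 1 for [true],
   2 for [false]. *)
Definition e_not a := Minus (Lit 1) a.
Definition e_and a b := Ite a b (Lit 0).
Definition e_or a b := Ite a (Lit 1) b.
Definition e_eq a b := Ite (Plus (Minus a b) (Minus b a)) (Lit 0) (Lit 1).

(* Without multiplication, [n * x] is computed as a sum of [n] terms [x]. *)
Definition e_adj x y := Inp (Plus (Tot 7 (Var x)) (Var y)).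

Definition e_deg x P := Tot 6 (e_and P (e_adj x 6)).

Definition e_card a := Tot 6 (e_and (Cell a (Var 6)) (Lit 1)).

(* Iterated [n] times, this removes everything from the work copy just when it
   induces a forest. *)
Definition strip :=
  Map 1 5 (e_and (Cell 1 (Var 5)) (Minus (e_deg 5 (Cell 1 (Var 6))) (Lit 1))).

(** The test [g] refers to the vertex [Var 5], and matters only where this is the vertex [Var 4]
    under consideration. *)
Definition try_add g :=
  Then (Map 1 5 (e_or (Cell 0 (Var 5)) (e_eq (Var 5) (Var 4))))
 (Then (For 3 strip)
       (Map 0 5 (e_or (e_and (e_eq (Var 5) (Var 4)) (e_and g (e_not (e_card 1))))
                      (Cell 0 (Var 5))))).

Definition greedy g := For 4 (try_add g).

Definition e_degU := e_deg 5 (e_or (e_eq (Var 6) (Var 0)) (e_eq (Var 6) (Var 1))).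
Definition e_single := e_and (Cell 3 (Var 5)) (e_not (Minus e_degU (Lit 1))).
Definition e_terminal := e_and (Cell 3 (Var 5)) (e_eq e_degU (Lit 1)).
Definition e_degL k := e_deg 5 (e_eq (Cell 4 (Var 6)) (Lit k)).

Definition set_root :=
  Map 4 5 (Ite (e_and (e_eq (Var 5) (Var 2))
                      (e_and (e_not (Cell 4 (Var 5))) e_terminal))
               (Lit 1) (Cell 4 (Var 5))).

Definition propagate :=
  Map 4 5 (Ite (e_and (e_eq (Var 5) (Var 4))
                      (e_and (e_not (Cell 4 (Var 5))) e_single))
               (Ite (e_degL 1) (Ite e_terminal (Lit 2) (Lit 1))
                    (Ite (e_degL 2) (Ite e_terminal (Lit 1) (Lit 2))
                         (Lit 0)))
               (Cell 4 (Var 5))).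

(** The sweeps make the labelled set closed under adjacency before the next root is tried; otherwise
    one tree could receive two roots. *)
Definition label :=
  Then (Map 4 5 (Lit 0)) (For 2 (Then set_root (For 3 (For 4 propagate)))).

(** If [U] with its label class is a forest, the first two passes keep all of it. If not, the result
    is still a maximal forest, so pairs meeting the first forest do no harm and are not filtered
    out. *)
Definition candidate k :=
  Then (Map 0 5 (Lit 0))
 (Then (greedy (e_or (e_eq (Var 5) (Var 0)) (e_eq (Var 5) (Var 1))))
 (Then (greedy (e_eq (Cell 4 (Var 5)) (Lit k)))
 (Then (greedy (Lit 1))
       (Map 2 5 (Ite (Minus (e_card 2) (e_card 0)) (Cell 0 (Var 5)) (Cell 2 (Var 5))))))).

Definition init :=
  Then (Map 0 5 (Lit 0))
 (Then (greedy (Lit 1))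
 (Then (Map 2 5 (Cell 0 (Var 5))) (Map 3 5 (Cell 0 (Var 5))))).

Definition try_pair := Then label (Then (candidate 1) (candidate 2)).

Definition search :=
  Then init (For 0 (For 1 try_pair)).

(* As [Map] writes through array 1, this leaves the complement in the output. *)
Definition emit := Map 1 5 (e_not (Cell 2 (Var 5))).

Definition program := Seq (comp_com 0 search) (comp_com 0 emit).

(** * What the program computes *)

Section Correctness.
Variables (n : nat) (e : rel 'I_n).
Hypotheses (e_sym : symmetric e) (e_irr : irreflexive e).
Implicit Types (rho : nat -> nat) (sigma : nat -> nat -> nat).
Implicit Types (A B C F Fs G M R U : {set 'I_n}).
Local Notation inp := (arr (input e) 0).
Local Notation ev := (eval n inp).
Local Notation run := (sem n inp).
Local Notation dg := (dg e).
Local Notation forest := (forest e).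

Definition setof (f : nat -> nat) : {set 'I_n} := [set i : 'I_n | f i != 0].

Lemma inpE (i j : 'I_n) : inp (i * n + j) = e i j.
Proof.
rewrite /=; congr nat_of_bool.
apply/existsP/idP => [[i' /existsP [j' /andP [/eqP ij]]]|eij].
  suff [-> ->] : i = i' /\ j = j' by [].
  have n0 : 0 < n by apply: leq_ltn_trans (ltn_ord i).
  split; apply: val_inj => /=.
    by have := congr1 (divn^~ n) ij; rewrite !divnMDl // !divn_small // !addn0.
  by have := congr1 (modn^~ n) ij; rewrite !modnMDl !modn_small.
by exists i; apply/existsP; exists j; rewrite eqxx.
Qed.

Lemma ev_and rho sigma a b :
  (ev rho sigma (e_and a b) != 0) = (ev rho sigma a != 0) && (ev rho sigma b != 0).
Proof. by rewrite /=; case: (ev _ _ a != 0). Qed.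

Lemma ev_or rho sigma a b :
  (ev rho sigma (e_or a b) != 0) = (ev rho sigma a != 0) || (ev rho sigma b != 0).
Proof. by rewrite /=; case: (ev _ _ a != 0). Qed.

Lemma ev_not rho sigma a : (ev rho sigma (e_not a) != 0) = (ev rho sigma a == 0).
Proof. by rewrite /=; lia. Qed.

Lemma ev_eq rho sigma a b :
  (ev rho sigma (e_eq a b) != 0) = (ev rho sigma a == ev rho sigma b).
Proof. by rewrite /=; case: ifP; lia. Qed.

Lemma ev_adj rho sigma x y (i j : 'I_n) : x != 7 -> rho x = i -> rho y = j ->
  ev rho sigma (e_adj x y) = e i j.
Proof.
move=> x7 xi yj; rewrite -inpE /=; congr (nat_of_bool [exists _, _]).
have -> : \sum_(k < n) upd rho 7 k x + rho y = i * n + j; last by [].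
by rewrite yj /upd (negPf x7) xi sum_nat_const card_ord mulnC.
Qed.

Lemma ev_deg rho sigma x P (i : 'I_n) A : x != 7 -> x != 6 -> rho x = i ->
  (forall j : 'I_n, (ev (upd rho 6 j) sigma P != 0) = (j \in A)) ->
  ev rho sigma (e_deg x P) = dg A i.
Proof.
move=> x7 x6 xi PA; rewrite /= /dg [RHS]big_mkcond /=; apply: eq_bigr => j _.
rewrite -PA; case: ifP => // _; apply: (@ev_adj _ _ x 6) => //.
by rewrite /upd (negPf x6).
Qed.

Lemma ev_card rho sigma a : ev rho sigma (e_card a) = #|setof (sigma a)|.
Proof.
by rewrite /= -sum1_card [RHS]big_mkcond /=; apply: eq_bigr => j _; rewrite inE.
Qed.

Lemma setof_Map rho sigma a x g A :
  (forall i : 'I_n, (ev (upd rho x i) sigma g != 0) = (i \in A)) ->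
  setof (run rho sigma (Map a x g) a) = A.
Proof.
by move=> gA; apply/setP=> i; rewrite inE /= /upd eqxx ltn_ord gA.
Qed.

Lemma run_Then rho sigma c1 c2 :
  run rho sigma (Then c1 c2) = run rho (run rho sigma c1) c2.
Proof. by []. Qed.

Lemma run_For rho sigma x c (Inv : nat -> (nat -> nat -> nat) -> Prop) :
  Inv 0 sigma ->
  (forall i sigma', i < n -> Inv i sigma' -> Inv i.+1 (run (upd rho x i) sigma' c)) ->
  Inv n (run rho sigma (For x c)).
Proof.
move=> I0 step.
have step' k : k <= n ->
    Inv k (iteri k (fun i sigma' => run (upd rho x i) sigma' c) sigma).
  by elim: k => //= k IHk lt_k; apply: step => //; apply: IHk; exact: ltnW.
exact: step'.
Qed.

Lemma run_Map_neq rho sigma a x g b : b != a -> run rho sigma (Map a x g) b = sigma b.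
Proof. by rewrite /= /upd => /negPf ->. Qed.

Definition strip_set A := [set x in A | 1 < dg A x].

Lemma setof_strip rho sigma :
  setof (run rho sigma strip 1) = strip_set (setof (sigma 1)).
Proof.
apply: setof_Map => i; rewrite ev_and inE -subn_gt0 lt0n; congr (_ && _).
  by rewrite inE /= /upd.
rewrite -(@ev_deg (upd rho 5 i) sigma 5 (Cell 1 (Var 6))) // => j.
by rewrite inE /= /upd.
Qed.

(** A subset with all inner degrees at least 2 survives every round, and a nonempty fixed point is
    such a subset. A fixed point is reached within [n] rounds, because each earlier one removes a
    vertex. *)
Lemma strip_forest A : (iter n strip_set A == set0) <-> forest A.
Proof.
have strip_sub B : strip_set B \subset B by apply/subsetP=> x; rewrite inE => /andP [].
have iter_sub k : iter k strip_set A \subset A.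
  by elim: k => //= k IHk; apply: subset_trans (strip_sub _) IHk.
have fixed : strip_set (iter n strip_set A) = iter n strip_set A.
  have fixed_or k : (strip_set (iter k strip_set A) == iter k strip_set A) ||
      (#|iter k strip_set A| + k <= n).
    elim: k => [|k] /=.
      by rewrite addn0 -[X in _ <= X]card_ord max_card orbT.
    case/orP => [/eqP eq|le_k]; first by rewrite !eq eqxx.
    have [eq|neq] := eqVneq (strip_set (iter k strip_set A)) (iter k strip_set A).
      by rewrite !eq eqxx.
    have : strip_set (iter k strip_set A) \proper iter k strip_set A.
      by rewrite properEneq neq strip_sub.
    move/proper_card => lt_k; apply/orP; right; rewrite addnS -addSn.
    by apply: leq_trans le_k; rewrite leq_add2r.
  have /orP [/eqP//|] := fixed_or n.
  rewrite addnC -leq_subRL // subnn leqn0 cards_eq0 => /eqP ->.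
  by apply/eqP; rewrite -subset0.
split=> [/eqP it0|fA].
  move=> B sBA B0; apply/exists_inP; apply: contraT => /exists_inPn dB.
  have sub k : B \subset iter k strip_set A.
    elim: k => //= k IHk; apply/subsetP=> x xB; rewrite inE (subsetP IHk) //=.
    by apply: leq_trans (dgS e x IHk); rewrite ltnNge; exact: dB.
  by have := sub n; rewrite it0 subset0 (negPf B0).
apply/negPn/negP => K0; have [x] := fA _ (iter_sub n) K0.
by rewrite -{1}fixed inE => /andP [_]; case: leqP.
Qed.

Lemma run_strips rho sigma : exists2 sigma', run rho sigma (For 3 strip) = sigma' &
  (setof (sigma' 1) == set0 <-> forest (setof (sigma 1))) /\
  forall a, a != 1 -> sigma' a = sigma a.
Proof.
pose f := fun i sigma' => run (upd rho 3 i) sigma' strip.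
have strips k : setof (iteri k f sigma 1) = iter k strip_set (setof (sigma 1)) /\
    forall a, a != 1 -> iteri k f sigma a = sigma a.
  elim: k => //= k [IHk IHk']; split; first by rewrite setof_strip IHk.
  by move=> a a1; rewrite /f /strip run_Map_neq // IHk'.
exists (iteri n f sigma) => //; rewrite -strip_forest.
by have [-> ?] := strips n.
Qed.

(** The test [g] must mean membership in [G] for all contents of arrays 0 and 1, since these are
    overwritten along the way. *)
Lemma run_try_add rho sigma g v G : rho 4 = nat_of_ord v ->
  (forall sigma' x, (forall a, 1 < a -> sigma' a = sigma a) ->
     (ev (upd rho 5 (nat_of_ord x)) sigma' g != 0) = (x \in G)) ->
  exists2 sigma', run rho sigma (try_add g) = sigma' &
  [/\ forall a, 1 < a -> sigma' a = sigma a,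
    v \in G -> forest (v |: setof (sigma 0)) -> setof (sigma' 0) = v |: setof (sigma 0) &
    (v \in G -> ~ forest (v |: setof (sigma 0))) -> setof (sigma' 0) = setof (sigma 0)].
Proof.
move=> rv gG; rewrite /try_add !run_Then; set sigma1 := run rho sigma (Map 1 _ _).
have s1 : setof (sigma1 1) = v |: setof (sigma 0).
  apply: (@setof_Map rho sigma 1 5) => x; rewrite ev_or ev_eq !inE orbC.
  by rewrite /= /upd /= rv.
have [sigma2 s2E [s2 s2a]] := run_strips rho sigma1.
rewrite s2E; rewrite s1 in s2.
eexists; first by reflexivity.
have M2 : setof (sigma2 0) = setof (sigma 0) by rewrite s2a.
have frame a : 1 < a -> sigma2 a = sigma a.
  by move=> a1; rewrite s2a ?/sigma1 ?run_Map_neq //; lia.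
have addE (x : 'I_n) : (ev (upd rho 5 x) sigma2 (e_or (e_and (e_eq (Var 5) (Var 4))
    (e_and g (e_not (e_card 1)))) (Cell 0 (Var 5))) != 0) =
    [&& x == v, x \in G & setof (sigma2 1) == set0] || (x \in setof (sigma 0)).
  rewrite ev_or !ev_and ev_eq ev_not ev_card cards_eq0 gG //.
  by rewrite -M2 inE /= /upd /= rv.
split.
- by move=> a a1; rewrite run_Map_neq ?frame //; lia.
- move=> vG /s2 s20; apply: (@setof_Map rho sigma2 0 5) => x.
  rewrite addE s20 andbT !inE; case: eqP => //= ->; by rewrite vG.
- move=> nf; apply: (@setof_Map rho sigma2 0 5) => x.
  rewrite addE; case: eqP => //= ->; case: (boolP (v \in G)) => //= vG.
  by case: eqP => // /eqP /s2 /(nf vG).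
Qed.

Lemma run_greedy rho sigma g G :
  (forall sigma' v x, (forall a, 1 < a -> sigma' a = sigma a) ->
     (ev (upd (upd rho 4 v) 5 (nat_of_ord x)) sigma' g != 0) = (x \in G)) ->
  forest (setof (sigma 0)) ->
  exists2 sigma', run rho sigma (greedy g) = sigma' &
  [/\ forall a, 1 < a -> sigma' a = sigma a,
    forest (setof (sigma' 0)),
    setof (sigma 0) \subset setof (sigma' 0),
    setof (sigma' 0) \subset setof (sigma 0) :|: G &
    forall v, v \in G -> forest (v |: setof (sigma' 0)) -> v \in setof (sigma' 0)].
Proof.
move=> gG fM; eexists; first by reflexivity.
pose Inv i sigma' := [/\ forall a, 1 < a -> sigma' a = sigma a,
    forest (setof (sigma' 0)),
    setof (sigma 0) \subset setof (sigma' 0),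
    setof (sigma' 0) \subset setof (sigma 0) :|: G &
    forall v : 'I_n, v < i -> v \in G -> forest (v |: setof (sigma' 0)) ->
      v \in setof (sigma' 0)].
suff [fr fM' sM sMG mM] : Inv n (run rho sigma (greedy g)).
  by split=> // v; exact: mM.
apply: run_For => [|i sigma1 lt_i [fr fM1 sM1 sMG1 mM1]].
  by split=> //; exact: subsetUl.
have [|sigma2 -> [fr2 add2 skip2]] :=
    @run_try_add (upd rho 4 (Ordinal lt_i)) sigma1 g (Ordinal lt_i) G erefl.
  by move=> sigma' x fr'; apply: gG => a a1; rewrite fr' ?fr.
set v := Ordinal lt_i in add2 skip2.
set M1 := setof (sigma1 0) in fM1 sM1 sMG1 mM1 add2 skip2 *.
have fr' a : 1 < a -> sigma2 a = sigma a by move=> a1; rewrite fr2 ?fr.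
have ltS (u : 'I_n) : u < i.+1 -> u = v \/ u < i.
  by rewrite ltnS leq_eqVlt => /orP [/eqP ui|]; [left; exact: val_inj | right].
(* The stripped set being empty serves as the boolean form of [forest]. *)
have [/andP [vG /strip_forest fv]|nv] :=
    boolP ((v \in G) && (iter n strip_set (v |: M1) == set0)).
  rewrite /Inv (add2 vG fv); split=> //.
  - by apply: subset_trans sM1 _; exact: subsetUr.
  - by rewrite subUset sub1set inE vG orbT.
  - move=> u /ltS [->|ui] uG fu; first by rewrite setU11.
    rewrite in_setU1 mM1 ?orbT //; apply: forestS fu.
    by apply: setUS; exact: subsetUr.
have nv' : v \in G -> ~ forest (v |: M1).
  by move=> vG /strip_forest fv; rewrite vG fv in nv.
rewrite /Inv (skip2 nv'); split=> // u /ltS [->|ui] uG fu; last exact: mM1.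
by case: (nv' uG).
Qed.

Lemma run_MapE rho sigma a x g j : j < n ->
  run rho sigma (Map a x g) a j = ev (upd rho x j) sigma g.
Proof. by move=> lt_j; rewrite /= /upd eqxx lt_j. Qed.

Lemma ev_Ite rho sigma a b c :
  ev rho sigma (Ite a b c) = if ev rho sigma a != 0 then ev rho sigma b else ev rho sigma c.
Proof. by []. Qed.

Section Label.
Variables (u w : 'I_n) (F : {set 'I_n}).
Local Notation U := [set u; w].
Local Notation W := (single e F U).
Local Notation tm := (terminals e F U).

Definition lab_env rho sigma :=
  [/\ rho 0 = nat_of_ord u, rho 1 = nat_of_ord w & setof (sigma 3) = F].

Lemma ev_degU rho sigma (x : 'I_n) : lab_env rho sigma -> rho 5 = x ->
  ev rho sigma e_degU = dg U x.
Proof.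
move=> [r0 r1 _] r5; apply: ev_deg => // j.
by rewrite ev_or !ev_eq /= /upd /= r0 r1 !inE.
Qed.

Lemma ev_single rho sigma (x : 'I_n) : lab_env rho sigma -> rho 5 = x ->
  (ev rho sigma e_single != 0) = (x \in W).
Proof.
move=> env r5; rewrite ev_and ev_not inE; congr (_ && _).
  by case: env => _ _ <-; rewrite inE /= r5.
by rewrite -subn_eq0 -(ev_degU env r5).
Qed.

Lemma ev_terminal rho sigma (x : 'I_n) : lab_env rho sigma -> rho 5 = x ->
  (ev rho sigma e_terminal != 0) = (x \in tm).
Proof.
move=> env r5; rewrite ev_and ev_eq inE; congr (_ && _).
  by case: env => _ _ <-; rewrite inE /= r5.
by rewrite (ev_degU env r5).
Qed.

Definition labset sigma (p : bool) : {set 'I_n} :=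
  [set x : 'I_n | sigma 4 x == if p then 1 else 2].

Definition labs sigma := labset sigma true :|: labset sigma false.

(** The bound 2 makes being labelled the same as having a nonzero entry, which is what the program
    tests. *)
Definition label_ok sigma R :=
  labelled e W tm (labset sigma) R /\ forall x : 'I_n, sigma 4 x <= 2.

Lemma labs0 sigma (x : 'I_n) : (forall x : 'I_n, sigma 4 x <= 2) ->
  (x \in labs sigma) = (sigma 4 x != 0).
Proof. by move=> /(_ x); rewrite !inE; case: (sigma 4 x) => [|[|[|]]]. Qed.

Lemma ev_degL rho sigma (x : 'I_n) (p : bool) : rho 5 = x ->
  ev rho sigma (e_degL (if p then 1 else 2)) = dg (labset sigma p) x.
Proof.
move=> r5; apply: ev_deg => // j.
by rewrite ev_eq inE.
Qed.

Lemma labset_ext sigma sigma' : (forall x : 'I_n, sigma' 4 x = sigma 4 x) ->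
  labset sigma' = labset sigma.
Proof. by move=> eq4; apply/funext=> p; apply/setP=> x; rewrite !inE eq4. Qed.

Record grows sigma sigma' R R' : Prop := {
  gr_frame : forall a, a != 4 -> sigma' a = sigma a;
  gr_ok : label_ok sigma' R';
  gr_sub : labs sigma \subset labs sigma';
  (* A new root need not lie in [C]; without one, [R = R']. *)
  gr_closed : R = R' -> forall C, closedin e W C -> labs sigma \subset C ->
    labs sigma' \subset C }.

Lemma run_propagate rho sigma R (v : 'I_n) :
  lab_env rho sigma -> rho 4 = v -> label_ok sigma R ->
  grows sigma (run rho sigma propagate) R R /\
  (v \in W -> 0 < dg (labs sigma) v -> v \in labs (run rho sigma propagate)).
Proof.
move=> env r4 [lab le2]; set sigma' := run _ _ _.
have frame a : a != 4 -> sigma' a = sigma a by move=> a4; rewrite /sigma' run_Map_neq.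
have val (x : 'I_n) : x != v -> sigma' 4 x = sigma 4 x.
  move=> xv; rewrite /sigma' run_MapE // ev_Ite ev_and ev_eq /= /upd /= r4.
  by rewrite -(inj_eq val_inj) in xv; rewrite (negPf xv).
have env' : lab_env (upd rho 5 v) sigma by [].
have condv : (ev (upd rho 5 v) sigma (e_and (e_eq (Var 5) (Var 4))
    (e_and (e_not (Cell 4 (Var 5))) e_single)) != 0) = (v \notin labs sigma) && (v \in W).
  rewrite 2!ev_and ev_eq ev_not (@ev_single _ _ v) // labs0 // negbK.
  by rewrite /= /upd /= r4 eqxx.
have valv : sigma' 4 v = if (v \notin labs sigma) && (v \in W) then
    if 0 < dg (labset sigma true) v then if v \in tm then 2 else 1
    else if 0 < dg (labset sigma false) v then if v \in tm then 1 else 2 else 0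
    else sigma 4 v.
  rewrite /sigma' run_MapE // ev_Ite condv; case: ifP => // _.
  rewrite !ev_Ite !(@ev_terminal _ _ v) //.
  by rewrite (@ev_degL _ _ v true) // (@ev_degL _ _ v false) // -!lt0n.
have dU : dg (labs sigma) v = dg (labset sigma true) v + dg (labset sigma false) v.
  exact/dgU/(lab_disj lab).
have unchanged : sigma' 4 v = sigma 4 v ->
    grows sigma sigma' R R /\ labs sigma' = labs sigma.
  move=> eqv; have same (x : 'I_n) : sigma' 4 x = sigma 4 x.
    by have [->|/val] := eqVneq x v.
  have labE := labset_ext same; have lE : labs sigma' = labs sigma by rewrite /labs labE.
  split=> //; split; rewrite ?lE //.
  by split=> [|x]; rewrite ?labE ?same.
have [/andP [vL vW]|nvLW] := boolP ((v \notin labs sigma) && (v \in W)); last first.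
  rewrite (negPf nvLW) in valv; have [gr lE] := unchanged valv.
  by split=> // vW _; rewrite lE; move: nvLW; rewrite vW andbT negbK.
have v0 : sigma 4 v = 0 by apply/eqP; move: vL; rewrite labs0 // negbK.
rewrite vL vW /= in valv; have [dv|dv] := posnP (dg (labs sigma) v).
  have eqv : sigma' 4 v = sigma 4 v.
    by rewrite valv v0; move: dv; rewrite dU; do 2![case: (dg _ v) => //].
  by have [gr lE] := unchanged eqv.
have [p [dp valp]] : exists p, 0 < dg (labset sigma p) v /\
    sigma' 4 v = if p (+) (v \in tm) then 1 else 2.
  rewrite valv; case: ifP => [d1|d1]; first by exists true; split=> //; case: (v \in tm).
  exists false; have d2 : 0 < dg (labset sigma false) v by move: dv; rewrite dU; lia.
  by split=> //; rewrite d2; case: (v \in tm).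
have [y yL evy] := dg_gt0P _ _ _ dp.
have labE r : labset sigma' r =
    if r == p (+) (v \in tm) then v |: labset sigma r else labset sigma r.
  apply/setP=> x; rewrite [LHS]inE; have [->|xv] := eqVneq x v.
    have vr : v \notin labset sigma r by rewrite inE v0; case: (r).
    rewrite valp; move: vr.
    by case: r (p (+) _) => [] [] /= vr; rewrite ?setU11 ?(negPf vr).
  by rewrite val //; case: (r == _); rewrite !inE ?(negPf xv).
have lE : labs sigma' = v |: labs sigma.
  rewrite /labs !labE; case: (p (+) _) => /=; first by rewrite setUA.
  by rewrite setUCA.
split; last by rewrite lE setU11.
split=> //; rewrite ?lE ?subsetUr //.
- split.
    apply: (labelled_step e_sym e_irr lab vW vL yL evy); rewrite labE ?eqxx //.
    by case: (p (+) _).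
  move=> x; have [->|xv] := eqVneq x v; first by rewrite valp; case: ifP.
  by rewrite val.
- move=> _ C /closedinP closedC sC; rewrite subUset sC andbT sub1set.
  apply: (closedC y) => //; last by rewrite e_sym.
  by apply: (subsetP sC); rewrite inE; case: (p) yL => ->; rewrite ?orbT.
Qed.

Lemma grows_trans s1 s2 s3 R : grows s1 s2 R R -> grows s2 s3 R R -> grows s1 s3 R R.
Proof.
move=> [fr12 ok2 sub12 cl12] [fr23 ok3 sub23 cl23]; split=> //.
- by move=> a a4; rewrite fr23 ?fr12.
- exact: subset_trans sub12 sub23.
- by move=> _ C cC sC; apply: cl23 => //; exact: cl12.
Qed.

Lemma grows_env rho s1 s2 R R' : lab_env rho s1 -> grows s1 s2 R R' -> lab_env rho s2.
Proof. by move=> [r0 r1 FE] gr; split=> //; rewrite (gr_frame gr). Qed.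

Lemma env_upd rho sigma x i : 1 < x -> lab_env rho sigma -> lab_env (upd rho x i) sigma.
Proof. by move=> x1 [r0 r1 FE]; split; rewrite // /upd; case: x x1 => [|[|]]. Qed.

Lemma run_sweep rho sigma R : lab_env rho sigma -> label_ok sigma R ->
  let sigma' := run rho sigma (For 4 propagate) in grows sigma sigma' R R /\
  forall v, v \in W -> 0 < dg (labs sigma) v -> v \in labs sigma'.
Proof.
move=> env ok sigma'.
pose Inv i s := grows sigma s R R /\
  forall v : 'I_n, v < i -> v \in W -> 0 < dg (labs sigma) v -> v \in labs s.
suff [gr H] : Inv n sigma' by split=> // v; exact: H.
apply: run_For => [|i s lt_i [gr H]]; first by split.
have env' := env_upd i (isT : 1 < 4) (grows_env env gr).
have [gr' H'] := run_propagate (v := Ordinal lt_i) env' erefl (gr_ok gr).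
split; first exact: grows_trans gr gr'.
move=> v; rewrite ltnS leq_eqVlt => /orP [/eqP vi|vi] vW dv; last first.
  by apply: (subsetP (gr_sub gr')); exact: H.
have E : v = Ordinal lt_i by exact: val_inj.
rewrite E in vW dv *; apply: H' => //.
exact: leq_trans dv (dgS e _ (gr_sub gr)).
Qed.

(** A sweep from a labelling that is not closed labels a new vertex, and a closed one stays
    unchanged. After [n] sweeps the labelling is closed or comprises all vertices, hence is closed
    anyway. *)
Lemma run_sweeps rho sigma R : lab_env rho sigma -> label_ok sigma R ->
  let sigma' := run rho sigma (For 3 (For 4 propagate)) in
  grows sigma sigma' R R /\ closedin e W (labs sigma').
Proof.
move=> env ok sigma'.
pose Inv i s := grows sigma s R R /\ (closedin e W (labs s) || (i <= #|labs s|)).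
suff [gr cl] : Inv n sigma'.
  split=> //; have /orP [//|] := cl.
  rewrite -{1}[n]card_ord -cardsT => le_n.
  have /eqP -> : labs sigma' == setT by rewrite eqEcard subsetT.
  by apply/closedinP.
apply: run_For => [|i s lt_i [gr H]]; first by split; rewrite ?orbT.
have env' := env_upd i (isT : 1 < 3) (grows_env env gr).
have [gr' H'] := run_sweep env' (gr_ok gr); split; first exact: grows_trans gr gr'.
set s' := run _ _ _ in gr' H' *; have sub := gr_sub gr'.
have [cl|ncl] := boolP (closedin e W (labs s)).
  suff -> : labs s' = labs s by rewrite cl.
  by apply/eqP; rewrite eqEsubset sub andbT; exact: (gr_closed gr').
move: H; rewrite (negPf ncl) /= => le_i; apply/orP; right.
apply: leq_ltn_trans le_i _; apply: proper_card.
rewrite properE sub /=; apply: contra ncl => sub'.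
apply/closedinP => x y xL yW exy; apply: (subsetP sub'); apply: H' yW _.
by apply: (dg_ge1 xL); rewrite e_sym.
Qed.

Lemma run_set_root rho sigma R (i : 'I_n) : forest F ->
  lab_env rho sigma -> rho 2 = i -> label_ok sigma R ->
  closedin e W (labs sigma) ->
  let sigma' := run rho sigma set_root in
  exists R', grows sigma sigma' R R' /\ (i \in tm -> i \in labs sigma').
Proof.
move=> fF env r2 [lab le2] /closedinP cl sigma'.
have frame a : a != 4 -> sigma' a = sigma a by move=> a4; rewrite /sigma' run_Map_neq.
have val (x : 'I_n) : sigma' 4 x =
    if [&& x == i, x \notin labs sigma & x \in tm] then 1 else sigma 4 x.
  have env' : lab_env (upd rho 5 x) sigma by [].
  rewrite /sigma' run_MapE // ev_Ite 2!ev_and ev_eq ev_not (@ev_terminal _ _ x) //.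
  by rewrite labs0 // negbK /= /upd /= r2.
have [/andP [iL it]|nit] := boolP ((i \notin labs sigma) && (i \in tm)); last first.
  have same (x : 'I_n) : sigma' 4 x = sigma 4 x.
    by rewrite val; case: eqP => //= ->; rewrite (negPf nit).
  have labE := labset_ext same; have lE : labs sigma' = labs sigma by rewrite /labs labE.
  exists R; rewrite lE; split; last by move=> it; move: nit; rewrite it andbT negbK.
  split; rewrite ?lE //.
  by split=> [|x]; rewrite ?labE ?same.
have i0 : sigma 4 i = 0 by apply/eqP; move: iL; rewrite labs0 // negbK.
have val' (x : 'I_n) : sigma' 4 x = if x == i then 1 else sigma 4 x.
  by rewrite val; case: eqP => //= ->; rewrite iL it.
have labT : labset sigma' true = i |: labset sigma true.
  by apply/setP=> x; rewrite !inE val'; case: (x == i).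
have labF : labset sigma' false = labset sigma false.
  by apply/setP=> x; rewrite !inE val'; case: (eqVneq x i) => // ->; rewrite i0.
have lE : labs sigma' = i |: labs sigma by rewrite /labs labT labF setUA.
exists (i |: R); split; last by rewrite lE setU11.
split=> //; rewrite ?lE ?subsetUr //.
- split; last by move=> x; rewrite val'; case: ifP.
  apply: (labelled_root e_sym e_irr (forestS (single_sub e F U) fF)
    (terminals_sub e F U) lab it iL _ labT labF).
  by move=> y z yL zW; exact: cl.
- move=> RE; have iR : i \in R by rewrite RE setU11.
  by have := subsetP (lab_roots lab) i iR; rewrite inE (negPf iL) andbF.
Qed.

Lemma run_label rho sigma : forest F -> lab_env rho sigma ->
  let sigma' := run rho sigma label in
  (forall a, a != 4 -> sigma' a = sigma a) /\
  exists R, labelled e W tm (labset sigma') R /\ tm \subset labs sigma'.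
Proof.
move=> fF env sigma'; rewrite /sigma' /label run_Then.
set sigma0 := run _ _ (Map _ _ _).
have fr0 a : a != 4 -> sigma0 a = sigma a by move=> a4; rewrite /sigma0 run_Map_neq.
have val0 (x : 'I_n) : sigma0 4 x = 0 by rewrite /sigma0 run_MapE.
have env0 : lab_env rho sigma0 by case: env => r0 r1 FE; split; rewrite ?fr0.
have lab0 : labset sigma0 = fun=> set0.
  by apply/funext=> p; apply/setP=> x; rewrite !inE val0; case: p.
have ok0 : label_ok sigma0 set0.
  split=> [|x]; last by rewrite val0.
  rewrite lab0; apply: labelled0 => //.
  exact: forestS (single_sub e F U) fF.
pose Inv i s := (forall a, a != 4 -> s a = sigma0 a) /\
  exists R, [/\ label_ok s R, closedin e W (labs s) &
    forall v : 'I_n, v < i -> v \in tm -> v \in labs s].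
suff [fr [R [[lab _] _ H]]] : Inv n (run rho sigma0
    (For 2 (Then set_root (For 3 (For 4 propagate))))).
  split; first by move=> a a4; rewrite fr ?fr0.
  by exists R; split=> //; apply/subsetP=> v; exact: H.
apply: run_For => [|i s lt_i [fr [R [ok cl H]]]].
  split=> //; exists set0; split=> //.
  by apply/closedinP=> x y; rewrite /labs lab0 setU0 inE.
have env1 : lab_env (upd rho 2 i) s.
  apply: env_upd => //; case: env0 => r0 r1 FE; split=> //.
  by rewrite fr.
rewrite run_Then.
have [R' [gr1 H1]] := run_set_root (i := Ordinal lt_i) fF env1 erefl ok cl.
have [gr2 cl2] := run_sweeps (grows_env env1 gr1) (gr_ok gr1).
set s1 := run _ s _ in gr1 H1 gr2 cl2 *; set s2 := run _ s1 _ in gr2 cl2 *.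
split; first by move=> a a4; rewrite (gr_frame gr2) ?(gr_frame gr1) ?fr.
exists R'; split=> //; first exact: gr_ok gr2.
move=> v; rewrite ltnS leq_eqVlt => /orP [/eqP vi|vi] vt.
  apply: (subsetP (gr_sub gr2)); have E : v = Ordinal lt_i by exact: val_inj.
  by rewrite E in vt *; exact: H1.
by apply: (subsetP (gr_sub gr2)); apply: (subsetP (gr_sub gr1)); exact: H.
Qed.

Definition maximal_forest A := forest A /\ forall v, v \notin A -> ~ forest (v |: A).

Lemma leq_card_setC A B : #|A| <= #|B| -> #|~: B| <= #|~: A|.
Proof. by move=> le; rewrite -(leq_add2l #|B|) cardsC -(cardsC A) leq_add2r. Qed.

Lemma greedy_sub A B G : B \subset A :|: G ->
  (forall v, v \in G -> forest (v |: B) -> v \in B) ->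
  forest (A :|: G) -> G \subset B.
Proof.
move=> sB mB fAG; apply/subsetP=> v vG; apply: mB => //; apply: forestS fAG.
by rewrite subUset sub1set inE vG orbT.
Qed.

Lemma run_candidate rho sigma (p : bool) : lab_env rho sigma ->
  maximal_forest (setof (sigma 2)) ->
  let sigma' := run rho sigma (candidate (if p then 1 else 2)) in
  [/\ forall a, 2 < a -> sigma' a = sigma a,
    maximal_forest (setof (sigma' 2)),
    #|setof (sigma' 2)| <= #|setof (sigma 2)| &
    forest (U :|: labset sigma p) -> exists M,
      [/\ forest M, U :|: labset sigma p \subset M & #|setof (sigma' 2)| <= #|M|]].
Proof.
move=> [r0 r1 _] mB; rewrite /candidate !run_Then.
set s0 := run _ _ (Map 0 _ _).
have fr0 a : 1 < a -> s0 a = sigma a by move=> a1; rewrite /s0 run_Map_neq //; lia.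
have M0 : setof (s0 0) = set0 by apply: setof_Map => i; rewrite inE.
have f0 : forest (setof (s0 0)) by rewrite M0; apply: forest_card_le2; rewrite ?cards0.
have [|s1 -> [fr1 f1 _ sU1 mU1]] := @run_greedy rho s0
    (e_or (e_eq (Var 5) (Var 0)) (e_eq (Var 5) (Var 1))) U _ f0.
  by move=> s v x _; rewrite ev_or !ev_eq !inE /= /upd /= r0 r1.
have [|s2 -> [fr2 f2 s12 sL2 mL2]] := @run_greedy rho s1
    (e_eq (Cell 4 (Var 5)) (Lit (if p then 1 else 2))) (labset sigma p) _ f1.
  by move=> s v x fr; rewrite ev_eq inE /= fr // fr1 // fr0.
have [|s3 -> [fr3 f3 s23 _ mT3]] := @run_greedy rho s2 (Lit 1) setT _ f2.
  by move=> s v x _; rewrite inE.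
have fr a : 1 < a -> s3 a = sigma a by move=> a1; rewrite fr3 // fr2 // fr1 // fr0.
set s4 := run _ _ _; have B4 : setof (s4 2) =
    if #|setof (s3 0)| < #|setof (sigma 2)| then setof (s3 0) else setof (sigma 2).
  rewrite -(fr 2) //; apply: setof_Map => i; rewrite ev_Ite.
  rewrite (_ : ev _ _ (Minus _ _) = #|setof (s3 2)| - #|setof (s3 0)|); last first.
    by rewrite -!(ev_card (upd rho 5 i)).
  by rewrite subn_eq0 -ltnNge; case: ifP; rewrite inE.
have max3 : maximal_forest (setof (s3 0)).
  by split=> // v vM fv; rewrite mT3 ?inE in vM.
split.
- by move=> a a2; rewrite /s4 run_Map_neq ?fr //; lia.
- by rewrite B4; case: ifP.
- by rewrite B4; case: ltnP => // /ltnW.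
- move=> fUL; exists (setof (s3 0)).
  have U1 : U \subset setof (s1 0).
    apply: (greedy_sub sU1 mU1); rewrite M0 set0U.
    by apply: forestS fUL; exact: subsetUl.
  have U1' : setof (s1 0) \subset U by rewrite M0 set0U in sU1.
  have L2 : labset sigma p \subset setof (s2 0).
    apply: (greedy_sub sL2 mL2); apply: forestS fUL.
    exact: setSU.
  split; rewrite // ?B4; last by case: ltnP.
  by rewrite (subset_trans _ s23) // subUset L2 (subset_trans U1).
Qed.

Lemma run_pair rho sigma : forest F -> lab_env rho sigma ->
  maximal_forest (setof (sigma 2)) ->
  let sigma' := run rho sigma try_pair in
  [/\ setof (sigma' 3) = F, maximal_forest (setof (sigma' 2)),
    #|setof (sigma' 2)| <= #|setof (sigma 2)| &
    u \notin F -> w \notin F -> forall Fs,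
      #|between e F Fs U| <= #|~: setof (sigma' 2)|.*2 + 2].
Proof.
move=> fF env mB; rewrite /try_pair 2!run_Then.
have [fr1 [R [lab tmL]]] := run_label fF env; set s1 := run _ _ label in fr1 lab tmL *.
have env1 : lab_env rho s1 by case: env => r0 r1 FE; split; rewrite ?fr1.
have mB1 : maximal_forest (setof (s1 2)) by rewrite fr1.
have := run_candidate true env1 mB1; change (if true then 1 else 2) with 1.
set s2 := run _ _ (candidate 1) => -[fr2 mB2 le2 M2].
have env2 : lab_env rho s2 by case: env1 => r0 r1 FE; split; rewrite ?fr2.
have := run_candidate false env2 mB2; change (if false then 1 else 2) with 2.
set s3 := run _ _ (candidate 2) => -[fr3 mB3 le3 M3].
split=> //.
- by rewrite fr3 // fr2 // fr1 //; case: env.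
- by apply: leq_trans le3 _; rewrite -(fr1 2).
move=> uF wF Fs.
have dUF : [disjoint U & F].
  by rewrite disjoints_subset; apply/subsetP=> x; rewrite !inE => /orP [] /eqP ->.
have cU : #|U| <= 2 by rewrite cards2; case: (_ != _).
have U0 : U != set0 by apply/set0Pn; exists u; rewrite !inE eqxx.
have fU := forest_card_le2 e_irr cU.
have labE : labset s2 = labset s1 by apply: labset_ext => x; rewrite fr2.
have fUL p : forest (U :|: labset s1 p) := labelled_forestU e_sym e_irr fF dUF fU lab.
have [A2 [fA2 sA2 cA2]] := M2 (fUL true).
rewrite labE in M3; have [A3 [fA3 sA3 cA3]] := M3 (fUL false).
have le := two_forests e_sym e_irr dUF U0 cU lab tmL fA2 sA2 fA3 sA3.
have sR : R \subset tm by apply: subset_trans (lab_roots lab) (subsetIl _ _).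
apply: leq_trans (card_between_le e_sym e_irr Fs (lab_sep lab) sR dUF) _.
apply: leq_trans le _; rewrite leq_add2r -addnn.
by apply: leq_add; apply: leq_card_setC => //; exact: leq_trans cA2.
Qed.

End Label.

Lemma run_init rho sigma : let sigma' := run rho sigma init in
  setof (sigma' 2) = setof (sigma' 3) /\ maximal_forest (setof (sigma' 2)).
Proof.
rewrite /init !run_Then; set s0 := run _ _ (Map 0 _ _).
have M0 : setof (s0 0) = set0 by apply: setof_Map => i; rewrite inE.
have f0 : forest (setof (s0 0)) by rewrite M0; apply: forest_card_le2; rewrite ?cards0.
have [|s1 -> [_ f1 _ _ m1]] := @run_greedy rho s0 (Lit 1) setT _ f0.
  by move=> s v x _; rewrite inE.
set s2 := run _ _ (Map 2 _ _); set s3 := run _ _ _.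
have E2 : setof (s2 2) = setof (s1 0) by apply: setof_Map => i; rewrite inE.
have E3 : setof (s3 3) = setof (s1 0).
  by apply: setof_Map => i; rewrite inE /s2 /= /upd.
have E32 : s3 2 = s2 2 by rewrite /s3 run_Map_neq.
rewrite E32 E2 E3; split=> //; split=> // v vM fv.
by rewrite m1 ?inE in vM.
Qed.

Lemma run_search rho sigma : let B := setof (run rho sigma search 2) in
  maximal_forest B /\ exists F, [/\ forest F, #|B| <= #|F| &
    forall u w Fs, u \notin F -> w \notin F ->
      #|between e F Fs [set u; w]| <= #|~: B|.*2 + 2].
Proof.
rewrite /search run_Then; have [E23 mB] := run_init rho sigma.
set s0 := run _ _ init in E23 mB *; set F := setof (s0 3) in E23.
have fF : forest F by rewrite -E23; case: mB.
pose good u w s := forall Fs, u \notin F -> w \notin F ->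
  #|between e F Fs [set u; w]| <= #|~: setof (s 2)|.*2 + 2.
have goodW u w s s' : #|setof (s' 2)| <= #|setof (s 2)| -> good u w s -> good u w s'.
  move=> le g Fs uF wF; apply: leq_trans (g Fs uF wF) _.
  by rewrite leq_add2r leq_double leq_card_setC.
(* Pairs are treated in lexicographic order. A later replacement of the forest in array 2 only
   enlarges the complement, so earlier pairs stay good. *)
pose Inv i j s := [/\ setof (s 3) = F, maximal_forest (setof (s 2)),
  #|setof (s 2)| <= #|F| &
  forall u w : 'I_n, (u < i) || (u == i :> nat) && (w < j) -> good u w s].
suff [_ mB' leB gd] : Inv n 0 (run rho s0 (For 0 (For 1 try_pair))).
  by split=> //; exists F; split=> // u w Fs; apply: gd; rewrite ltn_ord.
apply: (run_For (Inv := fun i => Inv i 0)) => [|i s1 lt_i I1].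
  split=> //; first by rewrite E23.
  by move=> v w; rewrite !ltn0 andbF.
have [] : Inv i n (run (upd rho 0 i) s1 (For 1 try_pair)).
  apply: (run_For (Inv := Inv i)) => // j s2 lt_j [F2 mB2 le2 gd2].
  have env : lab_env (Ordinal lt_i) (Ordinal lt_j) F (upd (upd rho 0 i) 1 j) s2 by [].
  have [] := run_pair fF env mB2; set s3 := run _ _ _ => F3 mB3 le3 gd3.
  split=> //; first exact: leq_trans le3 le2.
  move=> u w; have [/andP [/eqP ui /eqP wj] _|nuw uw] :=
      boolP ((u == i :> nat) && (w == j :> nat)).
    have -> : u = Ordinal lt_i by exact: val_inj.
    have -> : w = Ordinal lt_j by exact: val_inj.
    by move=> Fs uF wF; exact: gd3.
  apply: goodW le3 _; apply: gd2; move: uw nuw; clear; lia.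
move=> F2 mB2 le2 gd2; split=> // u w; rewrite andbF orbF ltnS => le_u.
by apply: gd2; have := ltn_ord w; move: le_u; clear; lia.
Qed.

End Correctness.

Lemma output_emit n inp rho sigma s :
  (forall j, j < n -> arr s 1 j = eval n inp (upd rho 5 j) sigma (e_not (Cell 2 (Var 5)))) ->
  output n s = ~: setof n (sigma 2).
Proof.
move=> outE; apply/setP=> i; rewrite !inE outE // negbK /= /upd /=.
by case: (sigma 2 i).
Qed.

Lemma program_correct : exists q : {poly nat},
  forall (n : nat) (e : rel 'I_n), symmetric e -> irreflexive e ->
  exists t s, [/\ exec program (input e) t s, t <= q.[n]%R,
    minimal_fvs e (output n s) &
    exists2 k, k <= #|output n s| &
      mmfvs e <= k + k ^ 2 * (#|output n s|.*2 + 2)].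
Proof.
have [q1 q1P run1] := comp_comP search 0.
have [q2 q2P run2] := comp_MapP 1 5 (e_not (Cell 2 (Var 5))) 0.
have [q qP] := poly_bounded_add q1P q2P.
exists q => n e e_sym e_irr; set inp := arr (input e) 0.
pose rho0 (x : nat) := 0; pose sigma0 (a k : nat) := 0.
have rep0 : rep n inp rho0 sigma0 (input e) by [].
have [mB [F [fF leB bnd]]] := run_search e_sym e_irr rho0 sigma0.
set sigma1 := sem _ _ _ _ search in mB leB bnd.
set B := setof n (sigma1 2) in mB leB bnd.
have [t [s [ex le_t sP]]] : runs program (input e) (q1 n + q2 n)
    (fun s => output n s = ~: B).
  apply: runs_seq; first exact: (run1 _ _ _ _ _ rep0).
  move=> s1 [_ rep1]; apply: runs_weaken (leqnn _) _ (run2 _ _ _ _ _ rep1) => s.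
  by case=> _ _ /output_emit.
exists t, s; split=> //; first exact: leq_trans (qP n).
  rewrite sP; apply/minimal_fvsP => //; rewrite setCK; split; first by case: mB.
  by move=> v; rewrite inE; case: mB => _; apply.
(* [F] is the first forest; the final one is no larger, so the output has at least [k] elements. *)
exists #|~: F|; first by rewrite sP leq_card_setC.
apply/bigmax_leqP => S /asboolP /(minimal_fvsP e_sym e_irr) [fS mS].
have /(_ (#|~: B|.*2 + 2)) := card_minimal_fvs_le e_sym e_irr fF fS.
rewrite setCK sP; apply => [v|u w uF wF]; first by rewrite inE negbK; exact: mS.
exact: bnd.
Qed.

(* From the counting bound to the approximation ratio *)
From mathcomp Require Import all_classical all_reals all_analysis.
From mathcomp Require Import lra.
Import numFieldNormedType.Exports.
Import Order.TTheory GRing.Theory Num.Theory.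
Local Open Scope classical_set_scope.
Local Open Scope ring_scope.

Theorem theorem9 (R : realType) :
  exists (p : cmd) (q : {poly nat}) (r : nat -> R),
    [/\ forall n : nat, 1 <= r n,
        r =O_\oo (fun n : nat => n%:R `^ (2 / 3) : R) &
        forall (n : nat) (e : rel 'I_n), symmetric e -> irreflexive e ->
          exists (t : nat) (s : state),
            [/\ exec p (input e) t s,
                (t <= q.[n])%N,
                minimal_fvs e (output n s) &
                (mmfvs e)%:R / r n <= #|output n s|%:R :> R]].
Proof.
have [q correct] := program_correct.
pose x (n : nat) : R := n%:R `^ (2 / 3).
have x0 n : 0 <= x n by exact: powR_ge0.
have r1 n : 1 <= 1 + 4 * x n by rewrite lerDl mulr_ge0.
(* The 1 accounts for the summand [k], at most the output size [A], and the 4 for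
   [A.*2 + 2 <= 4 * A] when [A] is positive. Since [x n >= 1] for positive [n], the constant 5 works
   below. *)
exists program, q, (fun n => 1 + 4 * x n); split=> //.
  apply/eqO_exP; exists 5 => //; exists 1%N => // n /= n1.
  have x1 : 1 <= x n.
    by rewrite -(powRr0 n%:R) ler_powR ?ler1n //; apply: divr_ge0.
  rewrite !ger0_norm //; last by apply: le_trans (r1 n).
  by move: x1; rewrite /x; lra.
move=> n e e_sym e_irr.
have [t [s [ex le_t minS [k leA leO]]]] := correct n e e_sym e_irr.
exists t, s; split=> //; rewrite ler_pdivrMr; last exact: lt_le_trans (r1 n).
set A := #|output n s| in leA leO *.
pose c : R := n%:R `^ (1 / 3).
have c0 : 0 <= c by exact: powR_ge0.
have xE : x n = c ^+ 2.
  by rewrite /x /c -powR_mulrn ?powR_ge0 // -powRrM; congr (_ `^ _); lra.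
have nE : n%:R = c ^+ 3 :> R.
  rewrite /c -powR_mulrn ?powR_ge0 // -powRrM.
  by rewrite (_ : 1 / 3 * 3%:R = 1 :> R) ?powRr1 //; lra.
(* An empty output forces [k = 0], and then the counting bound gives [mmfvs e = 0]. *)
have [A0|A0] := posnP A.
  move: leO leA; rewrite A0 leqn0 => + /eqP k0.
  by rewrite k0 /= leqn0 => /eqP ->; rewrite mul0r.
have [lekc|ltck] := leP k%:R c.
  have leO' : (mmfvs e <= A + k ^ 2 * (4 * A))%N.
    apply: leq_trans leO _; rewrite leq_add // leq_mul2l; apply/orP; right; lia.
  apply: (@le_trans _ _ (A + k ^ 2 * (4 * A))%:R); first by rewrite ler_nat.
  rewrite natrD natrM natrX natrM xE.
  have : k%:R ^+ 2 <= c ^+ 2 :> R by rewrite lerXn2r ?nnegrE.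
  have : 1 <= A%:R :> R by rewrite ler1n.
  nra.
(* Now [A >= k > c], so the trivial bound [n], that is [c ^+ 3], is at most [c ^+ 2] times the
   output size. *)
have le_n : (mmfvs e <= n)%N.
  by apply/bigmax_leqP => S _; rewrite -[leqRHS]card_ord max_card.
apply: (@le_trans _ _ n%:R); first by rewrite ler_nat.
have ck : c <= A%:R :> R by apply: le_trans (ltW ltck) _; rewrite ler_nat.
rewrite nE xE.
have := ler_wpM2r (sqr_ge0 c) ck.
have : 0 <= A%:R * c ^+ 2 :> R by rewrite mulr_ge0 ?sqr_ge0.
have := ler0n R A; rewrite exprS; nra.
Qed.
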